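(* Let $\vartheta_3(z,\tau)=\sum_{n\in\mathbb{Z}} e^{2inz+\pi i n^2\tau}$ be the third Theta function, defined for $(z,\tau)\in\mathbb{C}\times\mathbb{H}$, where $\mathbb{H}=\{\tau\in\mathbb{C}:\operatorname{Im}(\tau)>0\}$. If $d>0$ is a positive constant, then for all $z\in\mathbb{C}$ $$\frac{1}{\sqrt{\pi d}}\sum_{n=-\infty}^{\infty} e^{-\frac{(z-n\pi)^2}{d\pi^2}}=\vartheta_3(z,i\pi d),$$ or equivalently, for all $z\in\mathbb{C}$, $$\frac{1}{\sqrt{\pi d}}\sum_{n=-\infty}^{\infty} e^{-\frac{(z-n)^2}{d}}=\vartheta_3(\pi z,i\pi d).$$
   Context: Here $i$ is the imaginary unit, $d$ is a real number, and $\sqrt{\pi d}$ denotes the positive square root. *)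

(* Defs.v *)
From Stdlib Require Import Reals ZArith.
From Coquelicot Require Export Coquelicot.

Open Scope C_scope.

Definition Cexp (z : C) : C := (exp (Re z) * cos (Im z), exp (Re z) * sin (Im z))%R.

Coercion IZC (n : Z) : C := RtoC (IZR n).

(* Convergence of a bilateral series means that the halves over n >= 0 and over
   n < 0 converge separately, not merely that its symmetric partial sums do. *)
Definition is_Zseries (a : Z -> C) (l : C) : Prop :=
  exists lp ln : C,
    @is_series C_AbsRing C_NormedModule (fun n : nat => a (Z.of_nat n)) lp /\
    @is_series C_AbsRing C_NormedModule (fun n : nat => a (- Z.of_nat (S n))%Z) ln /\
    l = lp + ln.

Definition ex_Zseries (a : Z -> C) : Prop := exists l : C, is_Zseries a l.

(* Unspecified when the series diverges. *)
Definition Zseries (a : Z -> C) : C :=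
  @iota C_CompleteNormedModule (is_Zseries a).

Definition theta3_term (z tau : C) (n : Z) : C :=
  Cexp (2 * Ci * n * z + PI * Ci * n ^ 2 * tau).

(* Total in tau; the series defining it converges on the upper half-plane
   0 < Im tau, and only there is the value meaningful. *)
Definition theta3 (z tau : C) : C := Zseries (theta3_term z tau).

(* Main.v *)
Require Import Defs.
From Stdlib Require Import Reals ZArith Lra Lia Psatz.
From Coquelicot Require Import Coquelicot.
From mathcomp Require ssrnat binomial.
Open Scope C_scope.

(** Polya's proof.  Expanding [cos u ^ (2m)] by the binomial theorem at
    [u = PI (w - k) / l] and summing over a full period of [l] integers [k]
    keeps only the frequencies divisible by [l]:
    [sum_k cos (PI (w - k) / l) ^ (2m)
       = l 4^-m sum_v binom (2m, m + l v) exp (2 PI i v w)].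
    Let [l] tend to infinity with [m ~ s l^2].  The left-hand terms tend to
    [exp (- s PI^2 (w - k)^2)] and the right-hand ones, divided by the central
    one, to [exp (- v^2 / s + 2 PI i v w)]; both sums converge by domination,
    and [sqrt m 4^-m binom (2m, m)] has a limit [kappa] by monotonicity.
    Instead of Wallis' product, the self-dual case [s = 1 / PI], [w = 0] yields
    [kappa = 1 / sqrt PI].  The theorem is the case [s = 1 / (PI^2 d)]. *)

(** * Complex exponential and cosine *)

(** The obstacle is that [w] is complex: off the real axis [cos] exceeds 1 in modulus, and so does
    [exp (- u^2)], so its high powers have no trivial bound. What saves the domination is that the
    argument [PI (w - k) / l] lies within [PI |w| / l] of the real point [- PI k / l]; the
    displacement costs only a factor [exp (10 m (PI |w| / l)^2)], which stays bounded because
    [m / l^2] does. The period is centred at 0 so that these real points stay in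
    [[- PI / 2, PI / 2]], away from the other maxima of [|cos|] at the nonzero multiples of [PI];
    there each power of the cosine is dominated by a Gaussian in [k]. On the frequency side the
    ratios of binomial coefficients are products of elementary factors, which replaces Stirling's
    formula. The prefactor [l 4^-m binom (2m, m)] equals [sqrt m 4^-m binom (2m, m)] divided by
    [sqrt (m / l^2)], hence tends to [kappa / sqrt s]. Since [kappa] depends on neither [s] nor [w],
    a single instance whose two sides are the same nonzero number determines it. *)

Lemma C_eq (x y : C) : Re x = Re y -> Im x = Im y -> x = y.
Proof. destruct x, y; simpl; congruence. Qed.

Lemma RtoC_neq_0 (x : R) : x <> 0%R -> RtoC x <> 0.
Proof. intros H X. apply H. now injection X. Qed.

Lemma Cexp_plus (x y : C) : Cexp (x + y) = Cexp x * Cexp y.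
Proof.
  destruct x as [a b], y as [c e]; unfold Cexp; apply C_eq; simpl;
    rewrite exp_plus, ?cos_plus, ?sin_plus; ring.
Qed.

Lemma Cexp_0 : Cexp 0 = 1.
Proof. unfold Cexp; apply C_eq; simpl; rewrite exp_0, ?cos_0, ?sin_0; ring. Qed.

Lemma Cexp_RtoC (x : R) : Cexp x = exp x.
Proof. unfold Cexp; apply C_eq; simpl; rewrite ?cos_0, ?sin_0; ring. Qed.

Lemma Cexp_pow (z : C) (n : nat) : Cexp z ^ n = Cexp (INR n * z).
Proof.
  induction n as [|n IH].
  - simpl. rewrite <- Cexp_0. f_equal. ring.
  - rewrite Cpow_S, IH, <- Cexp_plus, S_INR, RtoC_plus. f_equal. ring.
Qed.

Lemma Cmod_Cexp (z : C) : Cmod (Cexp z) = exp (Re z).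
Proof.
  unfold Cmod, Cexp; simpl fst; simpl snd.
  transitivity (sqrt (exp (Re z) ^ 2)); [|apply sqrt_pow2; left; apply exp_pos].
  f_equal. generalize (sin2_cos2 (Im z)). unfold Rsqr. intro H.
  replace (exp (Re z) ^ 2)%R
    with (exp (Re z) ^ 2 * (sin (Im z) * sin (Im z) + cos (Im z) * cos (Im z)))%R
    by (rewrite H; ring).
  ring.
Qed.

Lemma Cexp_neq_0 (z : C) : Cexp z <> 0.
Proof. apply Cmod_gt_0. rewrite Cmod_Cexp. apply exp_pos. Qed.

Lemma Cexp_opp (z : C) : Cexp (- z) = / Cexp z.
Proof.
  assert (H : Cexp (- z) * Cexp z = 1).
  { rewrite <- Cexp_plus, <- Cexp_0. f_equal. ring. }
  rewrite <- (Cmult_1_l (/ Cexp z)), <- H. field. apply Cexp_neq_0.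
Qed.

(** * Elementary bounds for exponential, sine and cosine *)

Lemma Im_le_Cmod (z : C) : (Rabs (Im z) <= Cmod z)%R.
Proof. eapply Rle_trans; [apply Rmax_r | apply Rmax_Cmod]. Qed.

Lemma Cmod_le_Re_Im (z : C) : (Cmod z <= Rabs (Re z) + Rabs (Im z))%R.
Proof.
  replace z with (RtoC (Re z) + Ci * RtoC (Im z)) at 1.
  - eapply Rle_trans; [apply Cmod_triangle|].
    rewrite Cmod_mult, Cmod_Ci, !Cmod_R. lra.
  - apply C_eq; simpl; ring.
Qed.

Lemma exp_le_exp (x y : R) : (x <= y -> exp x <= exp y)%R.
Proof. intros [H | ->]; [left; now apply exp_increasing | apply Rle_refl]. Qed.

Lemma exp_pow (x : R) (n : nat) : (exp x ^ n = exp (INR n * x))%R.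
Proof.
  induction n as [|n IH]; [simpl; now rewrite Rmult_0_l, exp_0|].
  rewrite S_INR, <- tech_pow_Rmult, IH, <- exp_plus. f_equal. ring.
Qed.

Lemma Cmod_Cexp_le (z : C) : (Cmod (Cexp z) <= exp (Cmod z))%R.
Proof.
  rewrite Cmod_Cexp. apply exp_le_exp.
  eapply Rle_trans; [apply Rle_abs | apply re_le_Cmod].
Qed.

Lemma exp_sub_1_sub_abs_le (x : R) : (Rabs x <= 1 -> 0 <= exp x - 1 - x <= 2 * x ^ 2)%R.
Proof.
  intros H. split. { generalize (exp_ineq1_le x); lra. }
  assert (Hx : (- 1 <= x <= 1)%R) by (apply Rabs_le_between; exact H).
  (* [exp x = exp (x/2)^2 <= 1 / (1 - x/2)^2] *)
  assert (H1 := exp_ineq1_le (- (x / 2))). rewrite exp_Ropp in H1.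
  assert (Hp := exp_pos (x / 2)).
  assert (H2 : (exp (x / 2) * (1 - x / 2) <= 1)%R).
  { apply Rmult_le_reg_l with (/ exp (x / 2))%R; [now apply Rinv_0_lt_compat|].
    rewrite <- Rmult_assoc, Rinv_l; lra. }
  assert (H3 : (exp x = exp (x / 2) * exp (x / 2))%R) by (rewrite <- exp_plus; f_equal; field).
  set (e := exp (x / 2)) in *.
  assert (H0 : (0 <= e * (1 - x / 2))%R) by (apply Rmult_le_pos; lra).
  assert (H4 : (e * (1 - x / 2) * (e * (1 - x / 2)) <= 1 * 1)%R)
    by (apply Rmult_le_compat; lra).
  rewrite Rmult_1_l in H4.
  rewrite H3.
  assert (H5 : (e * e * (1 - x / 2) ^ 2 <= (1 + x + 2 * x ^ 2) * (1 - x / 2) ^ 2)%R).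
  { replace (e * e * (1 - x / 2) ^ 2)%R with (e * (1 - x / 2) * (e * (1 - x / 2)))%R by ring.
    apply Rle_trans with (1 := H4).
    (* The quadratic factor is [(1 - x) (5/2 - x) / 2], nonnegative for [x <= 1]; its root at 1 is
       where the constant 2 of the bound comes from. *)
    assert ((1 + x + 2 * x ^ 2) * (1 - x / 2) ^ 2 - 1 = x ^ 2 * ((5/4) - x * (7/4) + x^2/2))%R by field.
    assert (0 <= x^2)%R by nra.
    assert (0 <= (5/4) - x * (7/4) + x^2/2)%R by nra. nra. }
  apply Rmult_le_reg_r in H5; nra.
Qed.

Lemma sin_abs_le (x : R) : (Rabs (sin x) <= Rabs x)%R.
Proof.
  destruct (Rtotal_order x 0) as [H | [-> | H]].
  - assert (H1 := sin_gt_x x H).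
    rewrite (Rabs_left x H). apply Rabs_le. split; [lra|].
    destruct (Rle_lt_dec (- PI) x) as [H2|H2].
    + assert (sin x <= 0)%R; [|lra].
      destruct H2 as [H2 | <-]; [left; now apply sin_lt_0_var|].
      rewrite sin_neg, sin_PI; lra.
    + generalize (SIN_bound x) PI_RGT_0 PI2_1. lra.
  - rewrite sin_0; lra.
  - assert (H1 := sin_lt_x x H).
    rewrite (Rabs_right x) by lra. apply Rabs_le. split; [|lra].
    destruct (Rle_lt_dec x PI) as [H2|H2].
    + assert (0 <= sin x)%R by (apply sin_ge_0; lra). lra.
    + generalize (SIN_bound x) PI_RGT_0 PI2_1. lra.
Qed.

Lemma cos_bound_quadratic (x : R) : (0 <= 1 - cos x <= x ^ 2 / 2)%R.
Proof.
  replace x with (2 * (x / 2))%R at 1 2 by field.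
  rewrite cos_2a_sin.
  assert (H := sin_abs_le (x / 2)). apply Rsqr_le_abs_1 in H. unfold Rsqr in H.
  nra.
Qed.

(** The mean value theorem for [sin t - t], whose derivative [cos t - 1] is controlled by
    [cos_bound_quadratic]. *)
Lemma sin_bound_cubic (x : R) : (Rabs (sin x - x) <= Rabs x ^ 3 / 2)%R.
Proof.
  destruct (MVT_gen (fun t => sin t - t)%R 0 x (fun t => cos t - 1)%R) as [c [Hc Hd]].
  - intros t _. auto_derive; [easy|ring].
  - intros t _. apply continuity_pt_filterlim.
    apply (ex_derive_continuous (fun t => sin t - t)%R). auto_derive; easy.
  - rewrite sin_0, !Rminus_0_r in Hd. rewrite Hd, Rabs_mult.
    assert (Rabs c <= Rabs x)%R.
    { unfold Rmin, Rmax in Hc. destruct (Rle_dec 0 x).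
      - rewrite !Rabs_right; lra.
      - rewrite !Rabs_left1; lra. }
    assert (H1 := cos_bound_quadratic c).
    assert (Rabs (cos c - 1) <= Rabs x ^ 2 / 2)%R.
    { rewrite Rabs_left1 by lra. apply Rle_trans with (c ^ 2 / 2)%R; [lra|].
      rewrite <- (pow2_abs c). assert (H2 := Rabs_pos c). nra. }
    assert (H2 := Rabs_pos x). nra.
Qed.

(** The real and imaginary parts of the remainder are at most [3 |z|^2] and [4 |z|^2]; the constant
    10 is a round upper bound for their sum. *)
Lemma Cexp_bound_quadratic (z : C) :
  (Cmod z <= 1 -> Cmod (Cexp z - 1 - z) <= 10 * Cmod z ^ 2)%R.
Proof.
  intros Hz.
  assert (Hx := re_le_Cmod z). assert (Hy := Im_le_Cmod z).
  eapply Rle_trans; [apply Cmod_le_Re_Im|].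
  destruct z as [x y]. simpl Re in *; simpl Im in *.
  set (r := Cmod (x, y)) in *.
  unfold Cexp; simpl.
  assert (H1 : (Rabs x <= 1)%R) by lra.
  assert (H2 := exp_sub_1_sub_abs_le x H1).
  assert (H3 := cos_bound_quadratic y). assert (H4 := sin_bound_cubic y).
  assert (H5 := sin_abs_le y).
  assert (X0 := Rabs_pos x). assert (Y0 := Rabs_pos y).
  assert (X2 : (x ^ 2 <= r ^ 2)%R) by (rewrite <- (pow2_abs x); nra).
  assert (Y2 : (y ^ 2 <= r ^ 2)%R) by (rewrite <- (pow2_abs y); nra).
  assert (Hx' : (-1 <= x <= 1)%R) by (apply Rabs_le_between; exact H1).
  assert (A : (Rabs (exp x * cos y + - (1) + - x) <= 3 * r ^ 2)%R).
  { replace (exp x * cos y + - (1) + - x)%R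
      with ((exp x - 1 - x) * cos y + (1 + x) * (cos y - 1))%R by ring.
    eapply Rle_trans; [apply Rabs_triang|]. rewrite !Rabs_mult.
    rewrite (Rabs_right (exp x - 1 - x)) by lra.
    rewrite (Rabs_left1 (cos y - 1)) by lra.
    rewrite (Rabs_right (1 + x)) by lra.
    assert (Rabs (cos y) <= 1)%R by (apply Rabs_le; apply COS_bound).
    assert (Z0 := Rabs_pos (cos y)). nra. }
  assert (B : (Rabs (exp x * sin y + - 0 + - y) <= 4 * r ^ 2)%R).
  { replace (exp x * sin y + - 0 + - y)%R
      with ((exp x - 1) * sin y + (sin y - y))%R by ring.
    eapply Rle_trans; [apply Rabs_triang|]. rewrite Rabs_mult.
    assert (E : (Rabs (exp x - 1) <= 3 * r)%R).
    { replace (exp x - 1)%R with ((exp x - 1 - x) + x)%R by ring.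
      eapply Rle_trans; [apply Rabs_triang|].
      rewrite (Rabs_right (exp x - 1 - x)) by lra. nra. }
    assert (Z0 := Rabs_pos (sin y)). assert (Z1 := Rabs_pos (exp x - 1)).
    assert (Rabs (exp x - 1) * Rabs (sin y) <= 3 * r * r)%R
      by (apply Rmult_le_compat; lra).
    assert (Rabs y ^ 3 / 2 <= r ^ 2 / 2)%R.
    { assert (Rabs y * Rabs y <= r * r)%R by (apply Rmult_le_compat; lra).
      assert (Rabs y * Rabs y * Rabs y <= r * r * 1)%R by (apply Rmult_le_compat; nra).
      lra. }
    lra. }
  assert (R0 := pow2_ge_0 r). lra.
Qed.

(** * Finite sums *)

Fixpoint csum (f : nat -> C) (n : nat) : C :=
  match n with O => 0 | S n' => csum f n' + f n' end.

Lemma csum_ext (f g : nat -> C) (n : nat) :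
  (forall k, (k < n)%nat -> f k = g k) -> csum f n = csum g n.
Proof.
  induction n as [|n IH]; intros H; simpl; [easy|].
  rewrite IH, H; auto.
Qed.

Lemma csum_plus (f g : nat -> C) (n : nat) :
  csum (fun k => f k + g k) n = csum f n + csum g n.
Proof. induction n as [|n IH]; simpl; [|rewrite IH]; ring. Qed.

Lemma csum_mult_l (a : C) (f : nat -> C) (n : nat) :
  csum (fun k => a * f k) n = a * csum f n.
Proof. induction n as [|n IH]; simpl; [|rewrite IH]; ring. Qed.

Lemma csum_0 (n : nat) : csum (fun _ => 0) n = 0.
Proof. induction n as [|n IH]; simpl; [|rewrite IH]; ring. Qed.

Lemma csum_const (a : C) (n : nat) : csum (fun _ => a) n = INR n * a.
Proof.
  induction n as [|n IH]; [simpl; ring|].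
  rewrite S_INR, RtoC_plus. simpl. rewrite IH. ring.
Qed.

Lemma csum_swap (f : nat -> nat -> C) (n m : nat) :
  csum (fun i => csum (f i) m) n = csum (fun j => csum (fun i => f i j) n) m.
Proof.
  induction n as [|n IH]; simpl; [now rewrite csum_0|].
  now rewrite IH, csum_plus.
Qed.

Lemma csum_S_l (f : nat -> C) (n : nat) :
  csum f (S n) = f O + csum (fun k => f (S k)) n.
Proof.
  induction n as [|n IH]; [simpl; ring|].
  change (csum f (S (S n))) with (csum f (S n) + f (S n)). rewrite IH. simpl. ring.
Qed.

Lemma csum_split (f : nat -> C) (n m : nat) :
  csum f (n + m) = csum f n + csum (fun k => f (n + k)%nat) m.
Proof.
  induction m as [|m IH]; simpl; [rewrite Nat.add_0_r; ring|].
  rewrite Nat.add_succ_r. simpl. rewrite IH. ring.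
Qed.

Lemma csum_rev (f : nat -> C) (n : nat) :
  csum f n = csum (fun k => f (n - S k)%nat) n.
Proof.
  induction n as [|n IH]; [easy|].
  rewrite csum_S_l with (f := fun k => f (S n - S k)%nat). simpl csum at 1.
  rewrite IH. replace (S n - 1)%nat with n by lia. rewrite Cplus_comm. f_equal.
Qed.

Lemma csum_mul (f : nat -> C) (l n : nat) :
  csum f (l * n) = csum (fun v => csum (fun r => f (l * v + r)%nat) l) n.
Proof.
  induction n as [|n IH]; [now rewrite Nat.mul_0_r|].
  rewrite Nat.mul_succ_r, csum_split, IH. reflexivity.
Qed.

Lemma csum_geom (q : C) (n : nat) : (q - 1) * csum (Cpow q) n = q ^ n - 1.
Proof. induction n as [|n IH]; simpl; [|rewrite Cmult_plus_distr_l, IH]; ring. Qed.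

Lemma sum_n_csum (f : nat -> C) (n : nat) :
  @sum_n C_AbelianMonoid f n = csum f (S n).
Proof.
  induction n as [|n IH].
  - rewrite sum_O. simpl. ring.
  - rewrite sum_Sn, IH. reflexivity.
Qed.

(** Half-open range, so that both halves of a bilateral series get [n] terms. *)
Definition zsum (F : Z -> C) (n : nat) : C :=
  csum (fun k => F (Z.of_nat k - Z.of_nat n)%Z) (2 * n).

Lemma zsum_ext (F G : Z -> C) (n : nat) :
  (forall k, (- Z.of_nat n <= k < Z.of_nat n)%Z -> F k = G k) -> zsum F n = zsum G n.
Proof. intros H. apply csum_ext. intros k Hk. apply H. lia. Qed.

Lemma zsum_halves (F : Z -> C) (n : nat) :
  zsum F n = csum (fun k => F (Z.of_nat k)) n + csum (fun k => F (- Z.of_nat (S k))%Z) n.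
Proof.
  unfold zsum. replace (2 * n)%nat with (n + n)%nat by lia.
  rewrite csum_split, Cplus_comm. f_equal.
  - apply csum_ext. intros k _. f_equal. lia.
  - rewrite csum_rev. apply csum_ext. intros k Hk. f_equal. lia.
Qed.

Lemma zsum_mult_l (a : C) (F : Z -> C) (n : nat) :
  zsum (fun k => a * F k) n = a * zsum F n.
Proof. apply csum_mult_l. Qed.

Lemma zsum_swap (F : Z -> Z -> C) (n m : nat) :
  zsum (fun i => zsum (F i) m) n = zsum (fun j => zsum (fun i => F i j) n) m.
Proof. apply (csum_swap (fun i j => F (Z.of_nat i - Z.of_nat n)%Z (Z.of_nat j - Z.of_nat m)%Z)). Qed.

(** The range starts at [- l n], itself a multiple of [l], so cutting it into blocks of length [l]
    puts the only multiple of [l] at the head of each block. *)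
Lemma zsum_multiples (F : Z -> C) (l n : nat) : (0 < l)%nat ->
  (forall j, ~ (Z.of_nat l | j)%Z -> F j = 0) ->
  zsum F (l * n) = zsum (fun v => F (Z.of_nat l * v)%Z) n.
Proof.
  intros Hl H. unfold zsum.
  replace (2 * (l * n))%nat with (l * (2 * n))%nat by lia.
  rewrite csum_mul. apply csum_ext. intros v _.
  destruct l as [|l]; [lia|].
  rewrite csum_S_l. rewrite (csum_ext _ (fun _ => 0)), csum_0.
  - rewrite Cplus_0_r. f_equal. lia.
  - intros r Hr. apply H. intros [q Hq].
    assert (E : (Z.of_nat (S r) = Z.of_nat (S l) * (q - Z.of_nat v + Z.of_nat n))%Z) by lia.
    set (t := (q - Z.of_nat v + Z.of_nat n)%Z) in E.
    destruct (Z_le_gt_dec t 0); nia.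
Qed.

Lemma zsum_S (F : Z -> C) (n : nat) :
  zsum F (S n) = zsum F n + (F (Z.of_nat n) + F (- Z.of_nat (S n))%Z).
Proof. rewrite !zsum_halves. cbn [csum]. ring. Qed.

Lemma zsum_extend (F : Z -> C) (n m : nat) : (n <= m)%nat ->
  (forall k : Z, (k < - Z.of_nat n \/ Z.of_nat n <= k)%Z -> F k = 0) ->
  zsum F m = zsum F n.
Proof.
  intros Hnm H. induction Hnm as [|m Hnm IH]; [easy|].
  rewrite zsum_S, IH, !H by lia. ring.
Qed.

(** * The finite transformation formula *)

Definition Ccos (u : C) : C := (Cexp (Ci * u) + Cexp (- (Ci * u))) / 2.

Definition bin (n k : nat) : R := INR (binomial.binomial n k).

Lemma bin_0_r (n : nat) : bin n 0 = 1%R.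
Proof. now destruct n. Qed.

Lemma bin_S_S (n k : nat) : bin (S n) (S k) = (bin n (S k) + bin n k)%R.
Proof. apply (plus_INR (binomial.binomial n (S k)) (binomial.binomial n k)). Qed.

Lemma bin_gt (n k : nat) : (n < k)%nat -> bin n k = 0%R.
Proof.
  revert k. induction n as [|n IH]; intros [|k] H; try lia; [easy|].
  rewrite bin_S_S, !IH by lia. ring.
Qed.

Lemma bin_sub (n k : nat) : (k <= n)%nat -> bin n (n - k) = bin n k.
Proof. intros H. unfold bin. f_equal. apply binomial.bin_sub. apply (Bool.reflect_iff _ _ ssrnat.leP); exact H. Qed.

(** The difference is taken in [R], so the identity also covers [n < k], where both coefficients
    vanish. *)
Lemma bin_absorb (n k : nat) :
  (INR (S k) * bin n (S k) = (INR n - INR k) * bin n k)%R.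
Proof.
  destruct (Nat.le_gt_cases k n) as [H|H].
  - unfold bin. rewrite <- minus_INR, <- !mult_INR by easy.
    f_equal. apply (binomial.mul_bin_left n k).
  - rewrite !bin_gt by lia. ring.
Qed.

Lemma bin_pos (n k : nat) : (k <= n)%nat -> (0 < bin n k)%R.
Proof.
  revert k. induction n as [|n IH]; intros [|k] H; try lia;
    rewrite ?bin_0_r; try lra.
  rewrite bin_S_S. assert (H1 := IH k ltac:(lia)).
  assert (H2 := pos_INR (binomial.binomial n (S k))). fold (bin n (S k)) in H2. lra.
Qed.

Lemma Cbinomial (q : C) (n : nat) : (1 + q) ^ n = csum (fun k => bin n k * q ^ k) (S n).
Proof.
  induction n as [|n IH].
  - simpl. rewrite bin_0_r. ring.
  - rewrite csum_S_l, bin_0_r, Cpow_S, IH.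
    rewrite (csum_ext (fun k => bin (S n) (S k) * q ^ S k)
      (fun k => bin n (S k) * q ^ S k + q * (bin n k * q ^ k))).
    2: { intros k _. rewrite bin_S_S, RtoC_plus, Cpow_S. ring. }
    rewrite csum_plus, csum_mult_l.
    assert (E : csum (fun k => bin n k * q ^ k) (S n) =
                1 + csum (fun k => bin n (S k) * q ^ S k) (S n)).
    { rewrite csum_S_l, bin_0_r. simpl. rewrite (bin_gt n (S n)) by lia. ring. }
    rewrite Cmult_plus_distr_r, Cmult_1_l. rewrite E at 1. simpl Cpow. ring.
Qed.

(** The absolute value encodes the symmetry [binom (2m, m + j) = binom (2m, m - j)], and the value
    is 0 for [|j| > m], so sums over [j] can be extended at will. Dividing by the central
    coefficient gives a quantity with a pointwise limit. *)
Definition beta (m : nat) (j : Z) : R := (bin (2 * m) (m + Z.abs_nat j) / bin (2 * m) m)%R.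

Definition central (m : nat) : R := (bin (2 * m) m / 4 ^ m)%R.

Lemma RtoC_INR_double (n : nat) : RtoC (INR (2 * n)) = 2 * INR n.
Proof. now rewrite mult_INR, RtoC_mult. Qed.

(** Factor [cos u = exp (- i u) (1 + exp (2 i u)) / 2] and expand: the [k]-th binomial term has
    frequency [2 (k - m)]. The strict inequality [m < J] makes the half-open range reach [j = m];
    leaving [J] free allows a range adapted to the period. *)
Lemma Ccos_pow (u : C) (m J : nat) : (m < J)%nat ->
  Ccos u ^ (2 * m) = central m * zsum (fun j => beta m j * Cexp (2 * Ci * u * j)) J.
Proof.
  intros HJ.
  assert (Hb : bin (2 * m) m <> 0%R) by (apply Rgt_not_eq, bin_pos; lia).
  assert (H4 : (4 ^ m <> 0)%R) by (apply pow_nonzero; lra).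
  rewrite (zsum_extend _ (S m)); [|lia|].
  2: { intros k Hk. unfold beta. rewrite bin_gt by lia. unfold Rdiv. rewrite Rmult_0_l. ring. }
  (* The half-open range starts at [- (m + 1)], one below the support of [beta m]. Peeling off that
     zero term leaves [2 m + 1] terms that match the binomial expansion one by one. *)
  unfold zsum. replace (2 * S m)%nat with (S (S (2 * m))) by lia.
  rewrite csum_S_l. unfold beta at 1. rewrite bin_gt by lia.
  assert (E : Ccos u = / 2 * Cexp (- (Ci * u)) * (1 + Cexp (2 * Ci * u))).
  { unfold Ccos. replace (2 * Ci * u) with (Ci * u + Ci * u) by ring.
    rewrite Cexp_plus, Cexp_opp. field. apply Cexp_neq_0. }
  rewrite E, !Cpow_mult_l, Cbinomial, Cexp_pow, <- !csum_mult_l.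
  replace ((0 / bin (2 * m) m)%R) with 0%R by (field; auto).
  rewrite Cmult_0_l, Cplus_0_l, <- csum_mult_l.
  apply csum_ext. intros k Hk.
  replace (Z.of_nat (S k) - Z.of_nat (S m))%Z with (Z.of_nat k - Z.of_nat m)%Z by lia.
  assert (Eb : bin (2 * m) (m + Z.abs_nat (Z.of_nat k - Z.of_nat m)) = bin (2 * m) k).
  { destruct (Nat.le_gt_cases m k).
    - f_equal. lia.
    - rewrite <- (bin_sub _ k) by lia. f_equal. lia. }
  unfold beta, central. rewrite Eb.
  rewrite Cexp_pow.
  replace (Cexp (2 * Ci * u * (Z.of_nat k - Z.of_nat m)%Z))
    with (Cexp (INR (2 * m) * - (Ci * u)) * Cexp (INR k * (2 * Ci * u))).
  2: { rewrite <- Cexp_plus. f_equal. unfold IZC.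
       rewrite minus_IZR, <- !INR_IZR_INZ, RtoC_minus, RtoC_INR_double. ring. }
  rewrite !RtoC_div by auto.
  rewrite Cpow_inv by (apply RtoC_neq_0; lra).
  replace (2 ^ (2 * m)) with (RtoC (4 ^ m)).
  2: { rewrite Cpow_mult_r, RtoC_pow, <- (RtoC_pow 2 2). do 2 f_equal. ring. }
  field. split; now apply RtoC_neq_0.
Qed.

Lemma Cexp_2PIi_Z (k : Z) : Cexp (2 * PI * Ci * k) = 1.
Proof.
  assert (H : sin (IZR k * PI) = 0%R) by (apply sin_eq_0_1; now exists k).
  unfold Cexp, IZC. apply C_eq; simpl;
    match goal with |- context [exp ?x] => replace x with 0%R by ring end; rewrite exp_0;
    match goal with |- context [cos ?x] => replace x with (2 * (IZR k * PI))%R by ring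
                  | |- context [sin ?x] => replace x with (2 * (IZR k * PI))%R by ring end.
  - rewrite cos_2a_sin, H. ring.
  - rewrite sin_2a, H. ring.
Qed.

(** The real part suffices: [cos (2 PI x) = 1 - 2 sin^2 (PI x)] forces [sin (PI x) = 0]. *)
Lemma Cexp_2PIi_eq_1 (x : R) : Cexp (2 * PI * Ci * x) = 1 -> exists k : Z, x = IZR k.
Proof.
  intros H. apply (f_equal Re) in H. unfold Cexp in H. simpl in H.
  match type of H with context [exp ?x] => replace x with 0%R in H by ring end.
  match type of H with context [cos ?y] => replace y with (2 * (x * PI))%R in H by ring end.
  rewrite exp_0, cos_2a_sin in H.
  assert (H1 : sin (x * PI) = 0%R) by nra.
  apply sin_eq_0_0 in H1. destruct H1 as [k Hk]. exists k.
  apply Rmult_eq_reg_r with PI; [easy|]. generalize PI_RGT_0; lra.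
Qed.

(** Orthogonality of the characters modulo [2 L]: when [2 L] does not divide [j], this is a
    geometric sum whose ratio [q] satisfies [q <> 1] and [q ^ (2 L) = 1]. *)
Lemma zsum_roots_of_unity (L : nat) (j : Z) : (0 < L)%nat ->
  zsum (fun k => Cexp (- (2 * PI * Ci * j * k / INR (2 * L)))) L =
  if Znumtheory.Zdivide_dec (Z.of_nat (2 * L)) j then RtoC (INR (2 * L)) else 0.
Proof.
  intros HL.
  assert (HlR : INR (2 * L) <> 0%R) by (apply not_0_INR; lia).
  assert (Hl : RtoC (INR (2 * L)) <> 0) by (now apply RtoC_neq_0).
  destruct (Znumtheory.Zdivide_dec (Z.of_nat (2 * L)) j) as [[q ->]|Hj].
  - rewrite (zsum_ext _ (fun _ => 1)).
    + unfold zsum. rewrite csum_const. ring.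
    + intros k _. rewrite <- (Cexp_2PIi_Z (- (q * k))). f_equal. unfold IZC.
      rewrite opp_IZR, !mult_IZR, <- INR_IZR_INZ, RtoC_opp, !RtoC_mult. field. easy.
  - set (q := Cexp (- (2 * PI * Ci * j / INR (2 * L)))).
    unfold zsum.
    (* The factor [exp (PI i j)] is [q ^ (- L)], the first term of the sum. *)
    rewrite (csum_ext _ (fun k => Cexp (PI * Ci * j) * q ^ k)).
    2: { intros k _. unfold q. rewrite Cexp_pow, <- Cexp_plus. f_equal. unfold IZC.
         rewrite minus_IZR, <- !INR_IZR_INZ, RtoC_minus.
         revert Hl. rewrite RtoC_INR_double. intros Hl. field.
         intros X. apply Hl. rewrite X. ring. }
    rewrite csum_mult_l.
    assert (Hq : q - 1 <> 0).
    { intro X. apply Hj.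
      destruct (Cexp_2PIi_eq_1 (- (IZR j / INR (2 * L)))) as [t Ht].
      - rewrite <- (Cplus_0_l 1), <- X.
        replace (q - 1 + 1) with q by ring. unfold q. f_equal.
        rewrite RtoC_opp, RtoC_div by easy. unfold IZC. field. easy.
      - exists (- t)%Z. apply eq_IZR. rewrite mult_IZR, opp_IZR, <- Ht, <- INR_IZR_INZ.
        field. easy. }
    assert (Hql : q ^ (2 * L) = 1).
    { unfold q. rewrite Cexp_pow, <- (Cexp_2PIi_Z (- j)). f_equal. unfold IZC.
      rewrite opp_IZR, RtoC_opp. field. easy. }
    replace (csum (Cpow q) (2 * L)) with (/ (q - 1) * ((q - 1) * csum (Cpow q) (2 * L)))
      by (field; easy).
    rewrite csum_geom, Hql. ring.
Qed.

Lemma zsum_Ccos_pow (w : C) (m L : nat) : (0 < L)%nat ->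
  zsum (fun k => Ccos (PI * (w - k) / INR (2 * L)) ^ (2 * m)) L =
  INR (2 * L) * central m *
  zsum (fun v => beta m (Z.of_nat (2 * L) * v) * Cexp (2 * PI * Ci * v * w)) (S m).
Proof.
  intros HL.
  assert (HlR : INR (2 * L) <> 0%R) by (apply not_0_INR; lia).
  assert (Hl : RtoC (INR (2 * L)) <> 0) by (now apply RtoC_neq_0).
  set (F := fun j => beta m j * Cexp (2 * PI * Ci * j * w / INR (2 * L))).
  set (E := fun j k : Z => Cexp (- (2 * PI * Ci * j * k / INR (2 * L)))).
  (* The frequency range [2 L (m + 1)] exceeds [m], as the expansion requires, and is a multiple of
     the period, so that keeping the multiples of [2 L] leaves exactly the range [m + 1]. *)
  rewrite (zsum_ext _ (fun k => zsum (fun j => central m * (F j * E j k)) (2 * L * S m))).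
  2: { intros k _. rewrite zsum_mult_l, (Ccos_pow _ m (2 * L * S m)) by nia.
       f_equal. apply zsum_ext. intros j _. unfold F, E.
       rewrite <- (Cmult_assoc (beta m j)), <- Cexp_plus. do 2 f_equal. field. easy. }
  rewrite zsum_swap.
  rewrite (zsum_ext _ (fun j => central m * (F j * zsum (E j) L))).
  2: { intros j _. rewrite !zsum_mult_l. reflexivity. }
  rewrite zsum_multiples by
    (lia || (intros j Hj; unfold E; rewrite zsum_roots_of_unity by easy;
     destruct (Znumtheory.Zdivide_dec _ j); [contradiction|ring])).
  rewrite <- zsum_mult_l. apply zsum_ext. intros v _.
  unfold E. rewrite zsum_roots_of_unity by easy.
  destruct (Znumtheory.Zdivide_dec _ _) as [_|X]; [|exfalso; apply X; now exists v; lia].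
  unfold F.
  replace (2 * PI * Ci * (Z.of_nat (2 * L) * v)%Z * w / INR (2 * L)) with (2 * PI * Ci * v * w).
  - ring.
  - unfold IZC. rewrite mult_IZR, <- INR_IZR_INZ, RtoC_mult. field. easy.
Qed.

(** * Limits of complex sequences *)

(** Going through the real sequence of distances turns complex limits into squeeze arguments;
    [is_series_Cconv] connects this notion with [is_series]. *)
Definition Cconv (f : nat -> C) (l : C) : Prop := is_lim_seq (fun n => Cmod (f n - l)) 0.

Lemma Cconv_le (f : nat -> C) (l : C) (e : nat -> R) :
  eventually (fun n => Cmod (f n - l) <= e n)%R -> is_lim_seq e 0 -> Cconv f l.
Proof.
  intros H He. apply (is_lim_seq_le_le_loc (fun _ => 0%R) _ e); [|apply is_lim_seq_const|easy].
  revert H. apply filter_imp. intros n H. split; [apply Cmod_ge_0|easy].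
Qed.

Lemma Cconv_ext (f g : nat -> C) (l : C) : (forall n, f n = g n) -> Cconv f l -> Cconv g l.
Proof. intros H. apply is_lim_seq_ext. intros n. now rewrite H. Qed.

Lemma Cconv_unique (f : nat -> C) (l1 l2 : C) : Cconv f l1 -> Cconv f l2 -> l1 = l2.
Proof.
  intros H1 H2.
  assert (H : is_lim_seq (fun _ => Cmod (l1 - l2)) 0).
  { apply (is_lim_seq_le_le (fun _ => 0%R) _ (fun n => Cmod (f n - l1) + Cmod (f n - l2))%R).
    - intros n. split; [apply Cmod_ge_0|].
      replace (l1 - l2) with (- (f n - l1) + (f n - l2)) by ring.
      eapply Rle_trans; [apply Cmod_triangle|]. rewrite Cmod_opp. apply Rle_refl.
    - apply is_lim_seq_const.
    - rewrite <- (Rplus_0_l 0). now apply is_lim_seq_plus'. }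
  apply is_lim_seq_unique in H. rewrite Lim_seq_const in H. injection H as H.
  apply Cmod_eq_0 in H. rewrite <- (Cplus_0_r l2), <- H. ring.
Qed.

Lemma Cconv_const (a : C) : Cconv (fun _ => a) a.
Proof.
  apply is_lim_seq_ext with (fun _ => 0%R); [|apply is_lim_seq_const].
  intros _. rewrite <- Cmod_0. f_equal. ring.
Qed.

Lemma Cconv_RtoC (f : nat -> R) (l : R) : is_lim_seq f l -> Cconv (fun n => RtoC (f n)) l.
Proof.
  intros H. apply Cconv_le with (fun n => Rabs (f n - l)).
  - apply filter_forall. intros n. rewrite <- RtoC_minus, Cmod_R. apply Rle_refl.
  - apply -> is_lim_seq_abs_0. replace 0%R with (l - l)%R by ring.
    apply is_lim_seq_minus'; [easy|apply is_lim_seq_const].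
Qed.

Lemma Cconv_plus (f g : nat -> C) (a b : C) :
  Cconv f a -> Cconv g b -> Cconv (fun n => f n + g n) (a + b).
Proof.
  intros Hf Hg. apply Cconv_le with (fun n => Cmod (f n - a) + Cmod (g n - b))%R.
  - apply filter_forall. intros n.
    replace (f n + g n - (a + b)) with ((f n - a) + (g n - b)) by ring. apply Cmod_triangle.
  - rewrite <- (Rplus_0_l 0). now apply is_lim_seq_plus'.
Qed.

Lemma Cconv_mult (f g : nat -> C) (a b : C) :
  Cconv f a -> Cconv g b -> Cconv (fun n => f n * g n) (a * b).
Proof.
  intros Hf Hg.
  apply Cconv_le with (fun n => Cmod (f n - a) * Cmod (g n - b)
    + (Cmod a * Cmod (g n - b) + Cmod b * Cmod (f n - a)))%R.
  - apply filter_forall. intros n.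
    replace (f n * g n - a * b)
      with ((f n - a) * (g n - b) + (a * (g n - b) + b * (f n - a))) by ring.
    rewrite <- !Cmod_mult. eapply Rle_trans; [apply Cmod_triangle|].
    apply Rplus_le_compat_l, Cmod_triangle.
  - replace 0%R with (0 * 0 + (Cmod a * 0 + Cmod b * 0))%R by ring.
    apply is_lim_seq_plus'; [now apply is_lim_seq_mult'|].
    apply is_lim_seq_plus'; (apply is_lim_seq_mult'; [apply is_lim_seq_const|easy]).
Qed.

Lemma Cconv_csum (f : nat -> nat -> C) (g : nat -> C) (K : nat) :
  (forall k, Cconv (fun n => f n k) (g k)) -> Cconv (fun n => csum (f n) K) (csum g K).
Proof.
  intros H. induction K as [|K IH]; simpl; [apply Cconv_const|now apply Cconv_plus].
Qed.

Lemma Cconv_Cmod_le (f : nat -> C) (l : C) (M : R) :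
  eventually (fun n => Cmod (f n) <= M)%R -> Cconv f l -> (Cmod l <= M)%R.
Proof.
  intros H Hf.
  assert (H1 : is_lim_seq (fun n => M + Cmod (f n - l))%R (M + 0)%R)
    by (apply is_lim_seq_plus'; [apply is_lim_seq_const|exact Hf]).
  assert (H2 : Rbar_le (Cmod l) (M + 0)%R).
  { apply (is_lim_seq_le_loc (fun _ => Cmod l) (fun n => M + Cmod (f n - l))%R);
      [|apply is_lim_seq_const|exact H1].
    revert H. apply filter_imp. intros n H.
    replace l with (f n + - (f n - l)) at 1 by ring.
    eapply Rle_trans; [apply Cmod_triangle|]. rewrite Cmod_opp. lra. }
  simpl in H2. lra.
Qed.

Lemma is_series_Cconv (a : nat -> C) (l : C) :
  @is_series C_AbsRing C_NormedModule a l <-> Cconv (fun n => csum a (S n)) l.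
Proof.
  unfold is_series. rewrite (@filterlim_locally_ball_norm C_AbsRing _ C_NormedModule eventually _).
  unfold Cconv. rewrite <- is_lim_seq_spec.
  split; intros H eps; generalize (H eps); apply filter_imp; intros n Hn.
  - rewrite Rminus_0_r, (Rabs_right _ (Rle_ge _ _ (Cmod_ge_0 _))), <- sum_n_csum. exact Hn.
  - rewrite Rminus_0_r, (Rabs_right _ (Rle_ge _ _ (Cmod_ge_0 _))), <- sum_n_csum in Hn. exact Hn.
Qed.

Lemma csum_tail_le (f : nat -> C) (M : nat -> R) (n p : nat) :
  (forall k, (k < S n + p)%nat -> Cmod (f k) <= M k)%R ->
  (Cmod (csum f (S n + p) - csum f (S n)) <= sum_n M (n + p) - sum_n M n)%R.
Proof.
  induction p as [|p IH]; intros H.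
  - rewrite !Nat.add_0_r, Rminus_diag. rewrite <- Cmod_0. right. f_equal. ring.
  - rewrite !Nat.add_succ_r, sum_Sn.
    change (csum f (S (S n + p))) with (csum f (S n + p) + f (S n + p)%nat).
    replace (csum f (S n + p) + f (S n + p)%nat - csum f (S n))
      with (csum f (S n + p) - csum f (S n) + f (S n + p)%nat) by ring.
    eapply Rle_trans; [apply Cmod_triangle|].
    assert (H1 := IH ltac:(intros k Hk; apply H; lia)).
    assert (H2 := H (S n + p)%nat ltac:(lia)).
    change plus with Rplus. change (S n + p)%nat with (S (n + p)) in *. lra.
Qed.

(** Tannery's theorem, with a number of terms [N n] that varies with [n]. Every fixed index is
    eventually below [N n], so the limit [g] inherits the majorant and its series converges. *)
Lemma csum_dominated_convergence (f : nat -> nat -> C) (g : nat -> C) (M : nat -> R)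
    (N : nat -> nat) :
  ex_series M ->
  eventually (fun n => forall k, (k < N n)%nat -> Cmod (f n k) <= M k)%R ->
  (forall k, Cconv (fun n => f n k) (g k)) ->
  (forall K, eventually (fun n => (K <= N n)%nat)) ->
  exists l : C, @is_series C_AbsRing C_NormedModule g l /\ Cconv (fun n => csum (f n) (N n)) l.
Proof.
  intros HM Hf Hg HN.
  assert (HgM : forall k, (Cmod (g k) <= M k)%R).
  { intros k. apply (Cconv_Cmod_le (fun n => f n k)); [|apply Hg].
    generalize (filter_and _ _ Hf (HN (S k))). apply filter_imp.
    intros n [H1 H2]. now apply H1. }
  destruct (@ex_series_le C_AbsRing C_CompleteNormedModule g M) as [l Hl]; [exact HgM|exact HM|].
  exists l. split; [exact Hl|]. apply is_series_Cconv in Hl.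
  destruct HM as [lM HM]. change (is_lim_seq (sum_n M) lM) in HM.
  assert (HM0 : forall n, (sum_n M n <= lM)%R).
  { apply is_lim_seq_incr_compare; [exact HM|]. intros n. rewrite sum_Sn.
    change plus with Rplus. generalize (Cmod_ge_0 (g (S n))) (HgM (S n)). lra. }
  unfold Cconv. apply is_lim_seq_spec. intros eps.
  assert (He : (0 < eps / 4)%R) by (generalize (cond_pos eps); lra).
  apply is_lim_seq_spec in HM. apply is_lim_seq_spec in Hl.
  (* One cut-off [K] makes both the tail of the majorant and the remainder of the series of [g]
     smaller than [eps / 4]; the finite part up to [K] then converges termwise. *)
  destruct (filter_and _ _ (HM (mkposreal _ He)) (Hl (mkposreal _ He))) as [K HK].
  destruct (HK K (le_n K)) as [HK1 HK2]. cbn [pos] in HK1, HK2.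
  assert (Hc := Cconv_csum f g (S K) Hg). apply is_lim_seq_spec in Hc.
  generalize (filter_and _ _ (Hc (mkposreal _ He)) (filter_and _ _ Hf (HN (S K)))).
  apply filter_imp. intros n [H1 [H2 H3]]. cbn [pos] in H1.
  apply Rabs_lt_between in HK2. apply Rabs_lt_between in H1.
  rewrite Rminus_0_r, (Rabs_right _ (Rle_ge _ _ (Cmod_ge_0 _))).
  replace (csum (f n) (N n) - l) with
    ((csum (f n) (N n) - csum (f n) (S K)) + ((csum (f n) (S K) - csum g (S K))
      + (csum g (S K) - l))) by ring.
  assert (H4 : (Cmod (csum (f n) (N n) - csum (f n) (S K)) <= lM - sum_n M K)%R).
  { replace (N n) with (S K + (N n - S K))%nat by lia.
    eapply Rle_trans; [apply csum_tail_le with (M := M)|].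
    - intros k Hk. apply H2. lia.
    - generalize (HM0 (K + (N n - S K))%nat). lra. }
  apply Rabs_lt_between in HK1.
  eapply Rle_lt_trans; [apply Cmod_triangle|].
  assert (H5 := Cmod_triangle (csum (f n) (S K) - csum g (S K)) (csum g (S K) - l)).
  lra.
Qed.

Lemma zsum_dominated_convergence (F : nat -> Z -> C) (G : Z -> C) (M : nat -> R)
    (N : nat -> nat) :
  ex_series M ->
  eventually (fun n => forall k, (- Z.of_nat (N n) <= k < Z.of_nat (N n))%Z ->
    Cmod (F n k) <= M (Z.abs_nat k))%R ->
  (forall k, Cconv (fun n => F n k) (G k)) ->
  (forall K, eventually (fun n => (K <= N n)%nat)) ->
  exists l : C, is_Zseries G l /\ Cconv (fun n => zsum (F n) (N n)) l.
Proof.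
  intros HM HF HG HN.
  destruct (csum_dominated_convergence (fun n k => F n (Z.of_nat k)) (fun k => G (Z.of_nat k)) M N)
    as [lp [Hp1 Hp2]]; auto.
  { revert HF. apply filter_imp. intros n H k Hk.
    replace (M k) with (M (Z.abs_nat (Z.of_nat k))) by (f_equal; lia). apply H. lia. }
  destruct (csum_dominated_convergence (fun n k => F n (- Z.of_nat (S k))%Z)
    (fun k => G (- Z.of_nat (S k))%Z) (fun k => M (S k)) N)
    as [ln [Hn1 Hn2]]; auto.
  { now apply (@ex_series_incr_1 R_AbsRing R_NormedModule M). }
  { revert HF. apply filter_imp. intros n H k Hk.
    replace (M (S k)) with (M (Z.abs_nat (- Z.of_nat (S k)))) by (f_equal; lia).
    apply H. lia. }
  exists (lp + ln). split; [now exists lp, ln|].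
  apply Cconv_ext with (2 := Cconv_plus _ _ _ _ Hp2 Hn2).
  intros n. now rewrite zsum_halves.
Qed.

Lemma is_Zseries_unique (a : Z -> C) (l1 l2 : C) :
  is_Zseries a l1 -> is_Zseries a l2 -> l1 = l2.
Proof.
  intros [p1 [n1 [Hp1 [Hn1 ->]]]] [p2 [n2 [Hp2 [Hn2 ->]]]].
  rewrite is_series_Cconv in Hp1, Hp2, Hn1, Hn2.
  now rewrite (Cconv_unique _ _ _ Hp1 Hp2), (Cconv_unique _ _ _ Hn1 Hn2).
Qed.

Lemma Zseries_unique (a : Z -> C) (l : C) : is_Zseries a l -> Zseries a = l.
Proof.
  intros H. apply (@iota_unique C_AbsRing C_CompleteNormedModule (is_Zseries a)); [|exact H].
  intros y Hy. now apply (is_Zseries_unique a).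
Qed.

(** Comparison with a geometric series of ratio [exp (-1)]: [a'] is the maximum over the reals of
    [a + (b + 1) t - c t^2], so the exponent is at most [a' - k]. *)
Lemma ex_series_gaussian (a b c : R) : (0 < c)%R ->
  ex_series (fun k => exp (a + b * INR k - c * INR k ^ 2)).
Proof.
  intros Hc. set (a' := (a + (b + 1) ^ 2 / (4 * c))%R).
  apply (@ex_series_le R_AbsRing R_CompleteNormedModule _ (fun k => exp a' * exp (-1) ^ k)%R).
  - intros k. change (norm ?x) with (Rabs x). rewrite Rabs_right by (left; apply exp_pos).
    rewrite exp_pow, <- exp_plus. apply exp_le_exp. unfold a'.
    assert (0 <= c * (INR k - (b + 1) / (2 * c)) ^ 2)%R
      by (apply Rmult_le_pos; [lra|apply pow2_ge_0]).
    assert (c * (INR k - (b + 1) / (2 * c)) ^ 2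
      = c * INR k ^ 2 - (b + 1) * INR k + (b + 1) ^ 2 / (4 * c))%R by (field; lra).
    lra.
  - apply (@ex_series_scal R_AbsRing R_NormedModule). apply ex_series_geom.
    rewrite Rabs_right by (left; apply exp_pos). rewrite <- exp_0. apply exp_increasing. lra.
Qed.

(** * Asymptotics of the binomial coefficients *)

Lemma central_pos (m : nat) : (0 < central m)%R.
Proof. apply Rdiv_lt_0_compat; [apply bin_pos; lia|apply pow_lt; lra]. Qed.

Lemma central_S (m : nat) :
  central (S m) = (central m * (2 * INR m + 1) / (2 * INR m + 2))%R.
Proof.
  unfold central. replace (2 * S m)%nat with (S (S (2 * m))) by lia.
  assert (Hm := pos_INR m).
  assert (H4 : (4 ^ m <> 0)%R) by (apply pow_nonzero; lra).
  assert (E1 : bin (S (2 * m)) (S m) = bin (S (2 * m)) m).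
  { rewrite <- (bin_sub _ m) by lia. f_equal. lia. }
  rewrite bin_S_S, E1.
  assert (E2 := bin_absorb (2 * m) m).
  assert (E3 := bin_S_S (2 * m) m). rewrite E1 in E3.
  rewrite mult_INR, S_INR in E2. change (INR 2) with 2%R in E2.
  assert (E4 : (bin (2 * m) (S m) = INR m * bin (2 * m) m / (INR m + 1))%R).
  { apply (Rmult_eq_reg_l (INR m + 1)); [|lra]. rewrite E2. field. lra. }
  rewrite E3, E4. simpl pow. field. split; lra.
Qed.

(** The sequence increases because [(2m + 1)^2 >= 4 m (m + 1)], and it is bounded by 1. Only the
    existence of the limit is settled at this point. *)
Lemma central_sqrt_cv : exists kappa : R, is_lim_seq (fun m => sqrt (INR m) * central m)%R kappa.
Proof.
  apply ex_finite_lim_seq_incr with 1%R.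
  - intros m. rewrite central_S.
    assert (Hm := pos_INR m). assert (Hc := central_pos m). rewrite S_INR.
    replace (sqrt (INR m + 1) * (central m * (2 * INR m + 1) / (2 * INR m + 2)))%R
      with (sqrt (INR m + 1) * ((2 * INR m + 1) / (2 * INR m + 2)) * central m)%R by (field; lra).
    apply Rmult_le_compat_r; [lra|].
    rewrite <- (sqrt_pow2 ((2 * INR m + 1) / (2 * INR m + 2))).
    2: { apply Rmult_le_pos; [lra|]. left. apply Rinv_0_lt_compat. lra. }
    rewrite <- sqrt_mult_alt by lra. apply sqrt_le_1_alt.
    apply (Rmult_le_reg_r ((2 * INR m + 2) ^ 2)); [nra|].
    replace ((INR m + 1) * ((2 * INR m + 1) / (2 * INR m + 2)) ^ 2 * (2 * INR m + 2) ^ 2)%R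
      with ((INR m + 1) * (2 * INR m + 1) ^ 2)%R by (field; lra).
    nra.
  (* The product [m central(m)^2] itself increases, so the bound is carried by
     [(2m + 1) central(m)^2], which decreases from 1 because [(2m + 1) (2m + 3) <= (2m + 2)^2]. *)
  - assert (H : forall m, ((2 * INR m + 1) * central m ^ 2 <= 1)%R).
    { induction m as [|m IH].
      - unfold central. simpl. unfold bin. simpl. lra.
      - rewrite central_S, S_INR. assert (Hm := pos_INR m).
        eapply Rle_trans; [|exact IH].
        replace ((2 * (INR m + 1) + 1) * (central m * (2 * INR m + 1) / (2 * INR m + 2)) ^ 2)%R
          with ((2 * INR m + 3) * (2 * INR m + 1) / (2 * INR m + 2) ^ 2
                * ((2 * INR m + 1) * central m ^ 2))%R by (field; lra).
        rewrite <- (Rmult_1_l ((2 * INR m + 1) * central m ^ 2)) at 2.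
        apply Rmult_le_compat_r.
        + apply Rmult_le_pos; [lra|apply pow2_ge_0].
        + apply (Rmult_le_reg_r ((2 * INR m + 2) ^ 2)); [nra|].
          unfold Rdiv. rewrite Rmult_assoc, Rinv_l by nra. nra. }
    intros m. assert (Hm := pos_INR m). assert (Hc := central_pos m).
    apply Rsqr_incr_0_var; [|lra]. unfold Rsqr.
    replace (sqrt (INR m) * central m * (sqrt (INR m) * central m))%R
      with (sqrt (INR m) * sqrt (INR m) * central m ^ 2)%R by ring.
    rewrite sqrt_sqrt by easy. specialize (H m). nra.
Qed.

Lemma beta_nonneg (m : nat) (j : Z) : (0 <= beta m j)%R.
Proof.
  apply Rmult_le_pos; [apply pos_INR|]. left. apply Rinv_0_lt_compat, bin_pos. lia.
Qed.

Lemma beta_abs (m : nat) (j : Z) : beta m j = beta m (Z.of_nat (Z.abs_nat j)).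
Proof. unfold beta. do 3 f_equal. lia. Qed.

Lemma beta_0 (m : nat) : beta m 0 = 1%R.
Proof.
  unfold beta. simpl Z.abs_nat. rewrite Nat.add_0_r. apply Rdiv_diag.
  apply Rgt_not_eq, bin_pos. lia.
Qed.

Lemma beta_S (m j : nat) :
  beta m (Z.of_nat (S j)) = (beta m (Z.of_nat j) * (INR m - INR j) / (INR m + INR j + 1))%R.
Proof.
  unfold beta. rewrite !Zabs2Nat.id, Nat.add_succ_r.
  assert (H := bin_absorb (2 * m) (m + j)).
  rewrite S_INR, plus_INR, mult_INR in H. change (INR 2) with 2%R in H.
  assert (Hb : bin (2 * m) m <> 0%R) by (apply Rgt_not_eq, bin_pos; lia).
  assert (Hm := pos_INR m). assert (Hj := pos_INR j).
  apply (Rmult_eq_reg_l (INR m + INR j + 1)); [|lra].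
  replace ((INR m + INR j + 1) * (bin (2 * m) (S (m + j)) / bin (2 * m) m))%R
    with ((INR m + INR j + 1) * bin (2 * m) (S (m + j)) / bin (2 * m) m)%R by (field; auto).
  rewrite H. field. split; [auto|lra].
Qed.

(* The ratio of consecutive terms is [1 - (2i+1)/(m+i+1) <= exp (-(2i+1)/D)]. *)
Lemma beta_le_exp (m j : nat) (D : R) : (j <= m)%nat -> (INR m + INR j <= D)%R -> (0 < D)%R ->
  (beta m (Z.of_nat j) <= exp (- (INR j ^ 2 / D)))%R.
Proof.
  intros Hjm HD H0. induction j as [|j IH].
  - change (Z.of_nat 0) with 0%Z. rewrite beta_0. rewrite <- exp_0 at 1. right. f_equal. simpl. field. lra.
  - rewrite S_INR in *. assert (Hm := pos_INR m). assert (Hj := pos_INR j).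
    assert (Hjm' : (INR j + 1 <= INR m)%R) by (rewrite <- S_INR; now apply le_INR).
    rewrite beta_S.
    replace (- ((INR j + 1) ^ 2 / D))%R
      with (- (INR j ^ 2 / D) + - ((2 * INR j + 1) / D))%R by (field; lra).
    rewrite exp_plus. unfold Rdiv at 1. rewrite Rmult_assoc.
    apply Rmult_le_compat; [apply beta_nonneg| |apply IH; [lia|lra]|].
    { apply Rmult_le_pos; [lra|]. left. apply Rinv_0_lt_compat. lra. }
    eapply Rle_trans; [|apply exp_ineq1_le].
    assert ((2 * INR j + 1) / D <= (2 * INR j + 1) / (INR m + INR j + 1))%R.
    { apply Rmult_le_compat_l; [lra|]. apply Rinv_le_contravar; lra. }
    replace ((INR m - INR j) * / (INR m + INR j + 1))%R
      with (1 - (2 * INR j + 1) / (INR m + INR j + 1))%R by (field; lra).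
    lra.
Qed.

(* The ratio of consecutive terms is [1 / (1 + (2i+1)/(m-i)) >= exp (-(2i+1)/D)]. *)
Lemma beta_ge_exp (m j : nat) (D : R) : (j <= m)%nat -> (0 < D <= INR m - INR j + 1)%R ->
  (exp (- (INR j ^ 2 / D)) <= beta m (Z.of_nat j))%R.
Proof.
  intros Hjm HD. induction j as [|j IH].
  - change (Z.of_nat 0) with 0%Z. rewrite beta_0. rewrite <- exp_0. right. f_equal. simpl. field. lra.
  - rewrite S_INR in *. assert (Hm := pos_INR m). assert (Hj := pos_INR j).
    assert (Hjm' : (INR j + 1 <= INR m)%R) by (rewrite <- S_INR; now apply le_INR).
    rewrite beta_S.
    replace (- ((INR j + 1) ^ 2 / D))%R
      with (- (INR j ^ 2 / D) + - ((2 * INR j + 1) / D))%R by (field; lra).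
    rewrite exp_plus. unfold Rdiv at 3. rewrite Rmult_assoc.
    apply Rmult_le_compat; [left; apply exp_pos|left; apply exp_pos|apply IH; [lia|lra]|].
    rewrite exp_Ropp.
    replace ((INR m - INR j) * / (INR m + INR j + 1))%R
      with (/ (1 + (2 * INR j + 1) / (INR m - INR j)))%R by (field; lra).
    apply Rinv_le_contravar.
    { assert (0 <= (2 * INR j + 1) / (INR m - INR j))%R; [|lra].
      apply Rmult_le_pos; [lra|]. left. apply Rinv_0_lt_compat. lra. }
    eapply Rle_trans; [apply exp_ineq1_le|]. apply exp_le_exp.
    apply Rmult_le_compat_l; [lra|]. apply Rinv_le_contravar; lra.
Qed.

(** * Estimates for powers of the cosine *)

(** Telescoping of [a^n - b^n]. The usual exponent [n - 1] of [r] is raised to [n], which [1 <= r]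
    permits, and natural subtraction is avoided. *)
Lemma Cmod_pow_sub_le (a b : C) (r : R) (n : nat) : (1 <= r)%R -> (Cmod a <= r)%R -> (Cmod b <= r)%R ->
  (Cmod (a ^ n - b ^ n) <= INR n * Cmod (a - b) * r ^ n)%R.
Proof.
  intros Hr Ha Hb. induction n as [|n IH].
  - simpl. rewrite !Rmult_0_l. right. rewrite <- Cmod_0. f_equal. ring.
  - rewrite !Cpow_S, S_INR.
    replace (a * a ^ n - b * b ^ n) with (a * (a ^ n - b ^ n) + (a - b) * b ^ n) by ring.
    eapply Rle_trans; [apply Cmod_triangle|]. rewrite !Cmod_mult, Cmod_pow.
    assert (P : (Cmod b ^ n <= r ^ n)%R) by (apply pow_incr; split; [apply Cmod_ge_0|easy]).
    assert (P1 : (1 <= r ^ n)%R) by (apply pow_R1_Rle; easy).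
    assert (Hab := Cmod_ge_0 (a - b)). assert (Ha0 := Cmod_ge_0 a).
    assert (Hn := pos_INR n).
    assert (Q1 : (Cmod a * Cmod (a ^ n - b ^ n) <= r * (INR n * Cmod (a - b) * r ^ n))%R)
      by (apply Rmult_le_compat; auto using Cmod_ge_0).
    assert (Q2 : (Cmod (a - b) * Cmod b ^ n <= Cmod (a - b) * (r * r ^ n))%R).
    { apply Rmult_le_compat_l; [easy|]. nra. }
    simpl pow. lra.
Qed.

(** A cubic error is enough: with [|u|] of order [1 / l] and [m] of order [l^2], the [m]-th power
    accumulates an error of order [1 / l]. The constant is [120 + 10], from the product and from
    [d3]. *)
Lemma Ccos_sq_bound (u : C) : (Cmod u <= 1)%R ->
  (Cmod (Ccos u ^ 2 - Cexp (- u ^ 2)) <= 130 * Cmod u ^ 3)%R.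
Proof.
  intros Hu. set (z := Ci * u). set (r := Cmod u) in *.
  assert (Hz : Cmod z = r) by (unfold z; rewrite Cmod_mult, Cmod_Ci; apply Rmult_1_l).
  assert (Hr : (0 <= r)%R) by apply Cmod_ge_0.
  set (d1 := Cexp z - 1 - z). set (d2 := Cexp (- z) - 1 - - z).
  set (d3 := Cexp (- u ^ 2) - 1 - - u ^ 2).
  assert (H1 : (Cmod d1 <= 10 * r ^ 2)%R)
    by (rewrite <- Hz; apply Cexp_bound_quadratic; lra).
  assert (H2 : (Cmod d2 <= 10 * r ^ 2)%R).
  { rewrite <- Hz, <- (Cmod_opp z). apply Cexp_bound_quadratic. rewrite Cmod_opp. lra. }
  assert (Hu2 : Cmod (- u ^ 2) = (r ^ 2)%R) by (rewrite Cmod_opp, Cmod_pow; easy).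
  assert (H3 : (Cmod d3 <= 10 * (r ^ 2) ^ 2)%R).
  { rewrite <- Hu2. apply Cexp_bound_quadratic. rewrite Hu2. nra. }
  assert (Hz2 : z ^ 2 = - u ^ 2).
  { unfold z. rewrite Cpow_mult_l. replace (Ci ^ 2) with (- (1)); [ring|].
    apply C_eq; simpl; ring. }
  (* [cos^2 u = 1 + sinh^2 z] with [sinh z = z + (d1 - d2) / 2] *)
  assert (E : Ccos u ^ 2 - Cexp (- u ^ 2) = (d1 - d2) * (z + / 4 * (d1 - d2)) - d3).
  { unfold d3. rewrite <- Hz2. unfold Ccos. fold z.
    assert (Em : Cexp z * Cexp (- z) = 1) by
      (rewrite Cexp_opp; field; apply Cexp_neq_0).
    unfold d1, d2.
    transitivity ((Cexp z - Cexp (- z)) ^ 2 / 4 + Cexp z * Cexp (- z) - Cexp (z ^ 2)).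
    - simpl Cpow. field.
    - rewrite Em. field. }
  rewrite E.
  assert (H4 : (Cmod (d1 - d2) <= 20 * r ^ 2)%R).
  { eapply Rle_trans; [apply Cmod_triangle|]. rewrite Cmod_opp. lra. }
  eapply Rle_trans; [apply Cmod_triangle|]. rewrite Cmod_opp, Cmod_mult.
  assert (H5 : (Cmod (z + / 4 * (d1 - d2)) <= 6 * r)%R).
  { eapply Rle_trans; [apply Cmod_triangle|].
    rewrite Cmod_mult, <- RtoC_inv, Cmod_R, Rabs_right by lra. nra. }
  assert (H6 : (Cmod (d1 - d2) * Cmod (z + / 4 * (d1 - d2)) <= 20 * r ^ 2 * (6 * r))%R)
    by (apply Rmult_le_compat; auto using Cmod_ge_0).
  assert (H7 : (r ^ 4 <= r ^ 3)%R).
  { replace (r ^ 4)%R with (r ^ 3 * r)%R by ring. rewrite <- (Rmult_1_r (r ^ 3)) at 2.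
    apply Rmult_le_compat_l; [now apply pow_le|easy]. }
  replace ((r ^ 2) ^ 2)%R with (r ^ 4)%R in H3 by ring.
  replace (20 * r ^ 2 * (6 * r))%R with (120 * r ^ 3)%R in H6 by ring. lra.
Qed.

(** [Cmod_pow_sub_le] with the common bound [exp (131 |u|^2)] for both bases:
    [exp (|u|^2) + 130 |u|^3] is at most [exp (|u|^2) (1 + 130 |u|^2)], hence at most
    [exp (131 |u|^2)]. *)
Lemma Ccos_pow_sub_exp_le (u : C) (m : nat) : (Cmod u <= 1)%R ->
  (Cmod (Ccos u ^ (2 * m) - Cexp (INR m * - u ^ 2))
   <= INR m * (130 * Cmod u ^ 3) * exp (131 * (INR m * Cmod u ^ 2)))%R.
Proof.
  intros Hu. assert (H := Ccos_sq_bound u Hu). set (r := Cmod u) in *.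
  assert (Hr : (0 <= r)%R) by apply Cmod_ge_0.
  assert (Hr2 := pow2_ge_0 r).
  rewrite Cpow_mult_r, <- Cexp_pow.
  assert (He : (Cmod (Cexp (- u ^ 2)) <= exp (r ^ 2))%R).
  { eapply Rle_trans; [apply Cmod_Cexp_le|]. rewrite Cmod_opp, Cmod_pow. apply Rle_refl. }
  assert (He1 : (1 <= exp (r ^ 2))%R) by (generalize (exp_ineq1_le (r ^ 2)); lra).
  assert (E : (exp (131 * r ^ 2) = exp (r ^ 2) * exp (130 * r ^ 2))%R)
    by (rewrite <- exp_plus; f_equal; ring).
  assert (Hx := exp_ineq1_le (130 * r ^ 2)).
  assert (Hc : (Cmod (Ccos u ^ 2) <= exp (131 * r ^ 2))%R).
  { replace (Ccos u ^ 2) with (Cexp (- u ^ 2) + (Ccos u ^ 2 - Cexp (- u ^ 2))) by ring.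
    eapply Rle_trans; [apply Cmod_triangle|]. rewrite E.
    assert (r ^ 3 <= r ^ 2)%R by nra. nra. }
  replace (exp (131 * (INR m * r ^ 2))) with (exp (131 * r ^ 2) ^ m)%R.
  2: { rewrite exp_pow. f_equal. ring. }
  eapply Rle_trans; [apply Cmod_pow_sub_le with (r := exp (131 * r ^ 2))|].
  - rewrite E. nra.
  - easy.
  - rewrite E. nra.
  - apply Rmult_le_compat_r; [apply pow_le; left; apply exp_pos|].
    apply Rmult_le_compat_l; [apply pos_INR|easy].
Qed.

(** This form separates the decay due to the real part from the growth due to the imaginary part. *)
Lemma Cmod_Ccos_sq (u : C) :
  (Cmod (Ccos u) ^ 2 = 1 - sin (Re u) ^ 2 + sinh (Im u) ^ 2)%R.
Proof.
  destruct u as [a b]. simpl Re; simpl Im.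
  assert (E : Ccos (a, b) = (cosh b * cos a, - (sinh b * sin a))%R).
  { unfold Ccos, Cdiv. rewrite <- RtoC_inv by lra.
    replace (Ci * (a, b)) with ((- b, a)%R : C) by (apply C_eq; simpl; ring).
    replace (- ((- b, a)%R : C)) with ((b, - a)%R : C) by (apply C_eq; simpl; ring).
    unfold Cexp, cosh, sinh. simpl Re; simpl Im. rewrite cos_neg, sin_neg.
    apply C_eq; simpl; field. }
  rewrite E, Cmod2_alt. simpl Re; simpl Im.
  assert (H := sin2_cos2 a). unfold Rsqr in H.
  assert (Hc : (cosh b ^ 2 = 1 + sinh b ^ 2)%R).
  { unfold cosh, sinh. assert (exp b * exp (- b) = 1)%R
      by (rewrite <- exp_plus, Rplus_opp_r; apply exp_0).
    nra. }
  replace ((cosh b * cos a) ^ 2)%R with (cosh b ^ 2 * (cos a * cos a))%R by ring.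
  rewrite Hc. nra.
Qed.

Lemma sinh_sq_le (b : R) : (Rabs b <= 1 -> sinh b ^ 2 <= 9 * b ^ 2)%R.
Proof.
  intros Hb. assert (H1 := exp_sub_1_sub_abs_le b Hb).
  assert (H2 := exp_sub_1_sub_abs_le (- b)). rewrite Rabs_Ropp in H2. specialize (H2 Hb).
  assert (H0 := Rabs_pos b).
  assert (H3 : (Rabs (sinh b) <= Rabs (3 * b))%R).
  { unfold sinh.
    replace ((exp b - exp (- b)) / 2)%R
      with (b + ((exp b - 1 - b) - (exp (- b) - 1 - - b)) / 2)%R by field.
    eapply Rle_trans; [apply Rabs_triang|].
    rewrite Rabs_mult, (Rabs_right 3) by lra.
    assert (Rabs (((exp b - 1 - b) - (exp (- b) - 1 - - b)) / 2) <= b ^ 2)%R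
      by (apply Rabs_le; nra).
    assert (b ^ 2 <= Rabs b)%R by (rewrite <- (pow2_abs b); nra). lra. }
  apply Rsqr_le_abs_1 in H3. unfold Rsqr in H3. nra.
Qed.

(** A weak Jordan inequality [|sin x| >= |x| / 3]: on the interval [|x| <= 2], so
    [y - y^3 / 6 >= y / 3] for [y = |x|]. *)
Lemma sin_sq_ge (x : R) : (Rabs x <= PI / 2 -> x ^ 2 / 9 <= sin x ^ 2)%R.
Proof.
  assert (H : forall y, (0 <= y <= PI / 2 -> y ^ 2 / 9 <= sin y ^ 2)%R).
  { intros y Hy. assert (HP := PI_4).
    destruct (pre_sin_bound y 0) as [H _]; [lra|lra|].
    unfold sin_approx, sin_term in H. simpl in H.
    assert (y / 3 <= sin y)%R by nra. nra. }
  intros Hx. destruct (Rle_dec 0 x) as [H0|H0].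
  - apply H. rewrite Rabs_right in Hx; lra.
  - specialize (H (- x)%R). rewrite Rabs_left in Hx by lra.
    rewrite sin_neg in H. assert (H1 := H ltac:(lra)). nra.
Qed.

(** The source of the Gaussian majorant. With [u = a + i b] near the real point [x], one has [sin^2
    a >= sin^2 x / 2 - r^2 >= x^2 / 18 - r^2] and [sinh^2 b <= 9 r^2], so
    [|cos u|^2 <= 1 + 10 r^2 - x^2 / 18], which is at most the exponential of
    [10 r^2 - x^2 / 18]. *)
Lemma Ccos_pow_le (u : C) (x r : R) (m : nat) :
  (Rabs x <= PI / 2)%R -> (Cmod (u - x) <= r)%R -> (r <= 1)%R ->
  (Cmod (Ccos u ^ (2 * m)) <= exp (INR m * (10 * r ^ 2 - x ^ 2 / 18)))%R.
Proof.
  intros Hx Hu Hr.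
  assert (Hr0 : (0 <= r)%R) by (eapply Rle_trans; [apply Cmod_ge_0|exact Hu]).
  assert (Ha := re_le_Cmod (u - x)). assert (Hb := Im_le_Cmod (u - x)).
  destruct u as [a b]. simpl Re in Ha. simpl Im in Hb.
  replace (b + - 0)%R with b in Hb by ring. change (a + - x)%R with (a - x)%R in Ha.
  rewrite Cmod_pow, pow_mult, Cmod_Ccos_sq. simpl Re; simpl Im.
  assert (H1 := sin_sq_ge x Hx).
  assert (H2 : (sinh b ^ 2 <= 9 * r ^ 2)%R).
  { eapply Rle_trans; [apply sinh_sq_le; lra|].
    rewrite <- (pow2_abs b). assert (H0 := Rabs_pos b). nra. }
  assert (H3 : (sin x ^ 2 / 2 - r ^ 2 <= sin a ^ 2)%R).
  { assert (E : sin x = (sin a * cos (a - x) - cos a * sin (a - x))%R).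
    { rewrite <- sin_minus. f_equal. ring. }
    assert (Hs := sin_abs_le (a - x)).
    assert (S : (Rabs (sin x) <= Rabs (sin a) + r)%R).
    { rewrite E. eapply Rle_trans; [apply Rabs_triang|]. rewrite Rabs_Ropp, !Rabs_mult.
      assert (C1 : (Rabs (cos (a - x)) <= 1)%R) by (apply Rabs_le, COS_bound).
      assert (C2 : (Rabs (cos a) <= 1)%R) by (apply Rabs_le, COS_bound).
      assert (P1 := Rabs_pos (sin a)). assert (P2 := Rabs_pos (sin (a - x))).
      assert (P3 := Rabs_pos (cos a)).
      assert (Q1 : (Rabs (sin a) * Rabs (cos (a - x)) <= Rabs (sin a) * 1)%R)
        by (apply Rmult_le_compat_l; lra).
      assert (Q2 : (Rabs (cos a) * Rabs (sin (a - x)) <= 1 * r)%R)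
        by (apply Rmult_le_compat; lra).
      lra. }
    rewrite <- (pow2_abs (sin x)), <- (pow2_abs (sin a)).
    assert (P : (Rabs (sin x) ^ 2 <= (Rabs (sin a) + r) ^ 2)%R)
      by (apply pow_incr; split; [apply Rabs_pos|exact S]).
    assert (Q := pow2_ge_0 (Rabs (sin a) - r)). lra. }
  assert (H4 : (1 - sin a ^ 2 + sinh b ^ 2 <= exp (10 * r ^ 2 - x ^ 2 / 18))%R).
  { eapply Rle_trans; [|apply exp_ineq1_le]. lra. }
  assert (H5 : (0 <= 1 - sin a ^ 2 + sinh b ^ 2)%R).
  { assert (HS := SIN_bound a). assert (P := pow2_ge_0 (sinh b)). nra. }
  rewrite <- exp_pow. apply pow_incr. lra.
Qed.

(** * The limit of the finite formula *)

(** Even, to be the period [2 L] with [L = n + 1], and never 0. *)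
Definition lseq (n : nat) : nat := 2 * S n.

(** Rounding upwards keeps the ratio [rho s n] at or above [s] for every [n], so the decay rate in
    the majorants never drops below the one given by [s]. *)
Definition mseq (s : R) (n : nat) : nat := Z.to_nat (up (s * INR (lseq n) ^ 2)).

Definition rho (s : R) (n : nat) : R := (INR (mseq s n) / INR (lseq n) ^ 2)%R.

Lemma lseq_ge (n : nat) : (INR n + 1 <= INR (lseq n))%R.
Proof.
  unfold lseq. rewrite mult_INR, (S_INR n). change (INR 2) with 2%R. generalize (pos_INR n). lra.
Qed.

Lemma lseq_pos (n : nat) : (0 < INR (lseq n))%R.
Proof. generalize (lseq_ge n) (pos_INR n). lra. Qed.

Lemma lseq_inv_lim : is_lim_seq (fun n => / INR (lseq n))%R 0.
Proof.
  replace (Finite 0) with (Rbar_inv p_infty) by easy.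
  apply is_lim_seq_inv; [|easy].
  apply is_lim_seq_le_p_loc with INR; [|apply is_lim_seq_INR].
  apply filter_forall. intros n. generalize (lseq_ge n). lra.
Qed.

Lemma mseq_rho (s : R) (n : nat) : INR (mseq s n) = (rho s n * INR (lseq n) ^ 2)%R.
Proof. unfold rho. field. generalize (lseq_pos n). lra. Qed.

Lemma rho_bounds (s : R) (n : nat) : (0 < s)%R -> (s <= rho s n <= s + / INR (lseq n))%R.
Proof.
  intros Hs. assert (Hl := lseq_pos n). assert (Hl1 := lseq_ge n). assert (Hn := pos_INR n).
  assert (Hl2 : (0 < INR (lseq n) ^ 2)%R) by (apply pow_lt; easy).
  assert (Hx : (0 <= s * INR (lseq n) ^ 2)%R) by (apply Rmult_le_pos; lra).
  destruct (archimed (s * INR (lseq n) ^ 2)) as [U1 U2].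
  assert (E : INR (mseq s n) = IZR (up (s * INR (lseq n) ^ 2))).
  { unfold mseq. rewrite INR_IZR_INZ, Z2Nat.id; [easy|]. apply le_IZR. lra. }
  assert (R1 := mseq_rho s n). rewrite <- E in U1, U2. rewrite R1 in U1, U2.
  split; apply (Rmult_le_reg_r (INR (lseq n) ^ 2)); try easy; [lra|].
  replace ((s + / INR (lseq n)) * INR (lseq n) ^ 2)%R
    with (s * INR (lseq n) ^ 2 + INR (lseq n))%R by (field; lra).
  lra.
Qed.

Lemma rho_le (s : R) (n : nat) : (0 < s)%R -> (rho s n <= s + 1)%R.
Proof.
  intros Hs. assert (Hl1 := lseq_ge n). assert (Hn := pos_INR n).
  assert (/ INR (lseq n) <= 1)%R by (rewrite <- Rinv_1; apply Rinv_le_contravar; lra).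
  generalize (rho_bounds s n Hs). lra.
Qed.

Lemma rho_lim (s : R) : (0 < s)%R -> is_lim_seq (rho s) s.
Proof.
  intros Hs. apply is_lim_seq_le_le with (fun _ => s) (fun n => s + / INR (lseq n))%R.
  - intros n. now apply rho_bounds.
  - apply is_lim_seq_const.
  - replace (Finite s) with (Finite (s + 0)) by (f_equal; ring).
    apply is_lim_seq_plus'; [apply is_lim_seq_const|apply lseq_inv_lim].
Qed.

Lemma mseq_unbounded (s : R) (K : nat) : (0 < s)%R -> eventually (fun n => (K <= mseq s n)%nat).
Proof.
  intros Hs. destruct (nfloor_ex (INR K / s)) as [N HN].
  { apply Rmult_le_pos; [apply pos_INR|]. left. now apply Rinv_0_lt_compat. }
  exists N. intros n Hn. apply INR_le. rewrite mseq_rho.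
  assert (Hl1 := lseq_ge n). assert (Hn0 := pos_INR n). apply le_INR in Hn.
  destruct (rho_bounds s n Hs) as [R1 _].
  assert (Hk : (INR K <= s * (INR N + 1))%R).
  { replace (INR K) with (s * (INR K / s))%R by (field; lra).
    apply Rmult_le_compat_l; lra. }
  assert (s * (INR N + 1) <= rho s n * INR (lseq n))%R by (apply Rmult_le_compat; lra || generalize (pos_INR N); lra).
  assert (rho s n * INR (lseq n) * 1 <= rho s n * INR (lseq n) * INR (lseq n))%R
    by (apply Rmult_le_compat_l; [apply Rmult_le_pos|]; lra).
  lra.
Qed.

Lemma small_eventually (a b : R) : (0 < b)%R -> eventually (fun n => a / INR (lseq n) <= b)%R.
Proof.
  intros Hb.
  assert (H : is_lim_seq (fun n => a * / INR (lseq n))%R (a * 0)%R)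
    by (apply is_lim_seq_mult'; [apply is_lim_seq_const|apply lseq_inv_lim]).
  rewrite Rmult_0_r in H. apply is_lim_seq_spec in H.
  generalize (H (mkposreal b Hb)). apply filter_imp. intros n Hn. cbn [pos] in Hn.
  apply Rabs_lt_between in Hn. unfold Rdiv. lra.
Qed.

Lemma is_lim_seq_exp (u : nat -> R) (l : R) :
  is_lim_seq u l -> is_lim_seq (fun n => exp (u n)) (exp l).
Proof.
  intros H. apply (is_lim_seq_continuous exp); [|easy].
  apply derivable_continuous_pt, derivable_pt_exp.
Qed.

Lemma INR_abs_nat (k : Z) : INR (Z.abs_nat k) = Rabs (IZR k).
Proof. now rewrite INR_IZR_INZ, Zabs2Nat.id_abs, abs_IZR. Qed.

(** With [j = l k] and [k = |v|], the bounds [beta_ge_exp] and [beta_le_exp] are used with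
    [D = m - j + 1] and [D = m + j]. Dividing by [l^2] turns these into [rho - k / l + 1 / l^2] and
    [rho + k / l], both tending to [s], while [j^2 / l^2 = k^2]. *)
Lemma beta_lim (s : R) (v : Z) : (0 < s)%R ->
  is_lim_seq (fun n => beta (mseq s n) (Z.of_nat (lseq n) * v)) (exp (- (IZR v ^ 2 / s))).
Proof.
  intros Hs. set (k := Z.abs_nat v).
  assert (Hv : (IZR v ^ 2 = INR k ^ 2)%R) by (unfold k; now rewrite INR_abs_nat, pow2_abs).
  rewrite Hv. assert (Hk := pos_INR k).
  assert (Hlim : forall e : nat -> R, is_lim_seq e 0 ->
    is_lim_seq (fun n => exp (- (INR k ^ 2 / (rho s n + e n)))) (exp (- (INR k ^ 2 / s)))).
  { intros e He. apply is_lim_seq_exp.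
    apply (is_lim_seq_opp _ (Finite (INR k ^ 2 / s))).
    apply is_lim_seq_div'; [apply is_lim_seq_const| |lra].
    replace (Finite s) with (Finite (s + 0)) by (f_equal; ring). apply is_lim_seq_plus'; [now apply rho_lim|easy]. }
  assert (Hkl : is_lim_seq (fun n => INR k / INR (lseq n))%R 0).
  { rewrite <- (Rmult_0_r (INR k)).
    apply is_lim_seq_mult'; [apply is_lim_seq_const|apply lseq_inv_lim]. }
  refine (is_lim_seq_le_le_loc _ _ _ _ _ (Hlim (fun n => - (INR k / INR (lseq n)) + / INR (lseq n) * / INR (lseq n))%R _)
    (Hlim (fun n => INR k / INR (lseq n))%R _)).
  (* Once [k / l <= s], the index [l k] is at most [m], as both exponential bounds require. *)
  - generalize (small_eventually (INR k) s Hs). apply filter_imp. intros n Hn.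
    assert (Hl := lseq_pos n). destruct (rho_bounds s n Hs) as [R1 _].
    assert (Hi := Rinv_0_lt_compat _ Hl).
    assert (Hm := mseq_rho s n).
    rewrite beta_abs.
    replace (Z.abs_nat (Z.of_nat (lseq n) * v)) with (lseq n * k)%nat
      by (unfold k; rewrite Zabs2Nat.inj_mul, Zabs2Nat.id; easy).
    assert (Hj : INR (lseq n * k) = (INR k / INR (lseq n) * INR (lseq n) ^ 2)%R)
      by (rewrite mult_INR; field; lra).
    assert (Hl2 : (0 < INR (lseq n) ^ 2)%R) by (apply pow_lt; easy).
    assert (Hkl0 : (0 <= INR k / INR (lseq n))%R)
      by (apply Rmult_le_pos; lra).
    assert (Hjm : (lseq n * k <= mseq s n)%nat).
    { apply INR_le. rewrite Hj, Hm. apply Rmult_le_compat_r; lra. }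
    split.
    + eapply Rle_trans; [|apply (beta_ge_exp _ _ (INR (mseq s n) - INR (lseq n * k) + 1)); [easy|]].
      * right. do 2 f_equal. rewrite Hm, mult_INR. field.
        split; [|lra]. apply le_INR in Hjm. rewrite Hm, mult_INR in Hjm. lra.
      * apply le_INR in Hjm. lra.
    + eapply Rle_trans; [apply (beta_le_exp _ _ (INR (mseq s n) + INR (lseq n * k)))|].
      * easy.
      * lra.
      * rewrite Hm. generalize (pos_INR (lseq n * k)). nra.
      * right. do 2 f_equal. rewrite Hm, mult_INR. field.
        repeat split; nra.
  - replace 0%R with (- 0 + 0 * 0)%R by ring.
    apply is_lim_seq_plus'; [now apply (is_lim_seq_opp _ (Finite 0))|].
    apply is_lim_seq_mult'; apply lseq_inv_lim.
  - exact Hkl.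
Qed.

(** Uniform in [n]: within the support, [D = 2 m] gives the exponent [- k^2 / (2 rho)] with
    [rho <= s + 1]; outside it the coefficient is 0. *)
Lemma beta_bound (s : R) (n : nat) (v : Z) : (0 < s)%R ->
  (beta (mseq s n) (Z.of_nat (lseq n) * v) <= exp (- (INR (Z.abs_nat v) ^ 2 / (2 * (s + 1)))))%R.
Proof.
  intros Hs. rewrite beta_abs, Zabs2Nat.inj_mul, Zabs2Nat.id. set (k := Z.abs_nat v).
  destruct (Nat.le_gt_cases (lseq n * k) (mseq s n)) as [H|H].
  - assert (Hl := lseq_pos n). destruct (rho_bounds s n Hs) as [R1 _].
    assert (R2 := rho_le s n Hs). assert (Hm := mseq_rho s n).
    assert (Hl2 : (0 < INR (lseq n) ^ 2)%R) by (apply pow_lt; easy).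
    assert (Hm0 : (0 < INR (mseq s n))%R) by (rewrite Hm; apply Rmult_lt_0_compat; lra).
    eapply Rle_trans; [apply (beta_le_exp _ _ (2 * INR (mseq s n)))|].
    + easy.
    + apply le_INR in H. lra.
    + lra.
    + apply exp_le_exp, Ropp_le_contravar. rewrite Hm, mult_INR.
      replace ((INR (lseq n) * INR k) ^ 2 / (2 * (rho s n * INR (lseq n) ^ 2)))%R
        with (INR k ^ 2 / (2 * rho s n))%R by (field; lra).
      apply Rmult_le_compat_l; [apply pow2_ge_0|]. apply Rinv_le_contravar; lra.
  - unfold beta. rewrite bin_gt by lia. unfold Rdiv at 1. rewrite Rmult_0_l. left. apply exp_pos.
Qed.

Lemma Cmod_IZC (k : Z) : Cmod k = INR (Z.abs_nat k).
Proof. unfold IZC. now rewrite Cmod_R, INR_abs_nat. Qed.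

Lemma Cmod_PI : Cmod PI = PI.
Proof. rewrite Cmod_R. apply Rabs_right. generalize PI_RGT_0. lra. Qed.

Lemma beta_side_lim (s : R) (w : C) : (0 < s)%R ->
  exists l : C,
    is_Zseries (fun v => exp (- (IZR v ^ 2 / s)) * Cexp (2 * PI * Ci * v * w)) l /\
    Cconv (fun n => zsum (fun v => beta (mseq s n) (Z.of_nat (lseq n) * v)
                                   * Cexp (2 * PI * Ci * v * w)) (S (mseq s n))) l.
Proof.
  intros Hs.
  (* For complex [w] the character can grow like [exp (2 PI |w| |v|)], which the Gaussian factor
     from [beta_bound] absorbs. *)
  apply zsum_dominated_convergence
    with (M := fun k => exp (0 + 2 * PI * Cmod w * INR k - / (2 * (s + 1)) * INR k ^ 2)).
  - apply ex_series_gaussian. apply Rinv_0_lt_compat. lra.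
  - apply filter_forall. intros n k _.
    rewrite Cmod_mult, Cmod_R, (Rabs_right _ (Rle_ge _ _ (beta_nonneg _ _))).
    replace (0 + 2 * PI * Cmod w * INR (Z.abs_nat k) - / (2 * (s + 1)) * INR (Z.abs_nat k) ^ 2)%R
      with (- (INR (Z.abs_nat k) ^ 2 / (2 * (s + 1))) + 2 * PI * Cmod w * INR (Z.abs_nat k))%R
      by (field; lra).
    rewrite exp_plus. apply Rmult_le_compat; [apply beta_nonneg|apply Cmod_ge_0|now apply beta_bound|].
    eapply Rle_trans; [apply Cmod_Cexp_le|]. right. f_equal.
    rewrite !Cmod_mult, Cmod_Ci, Cmod_IZC, Cmod_PI, Cmod_R, Rabs_right by lra. ring.
  - intros k. apply Cconv_mult; [|apply Cconv_const].
    apply Cconv_RtoC. now apply beta_lim.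
  - intros K. generalize (mseq_unbounded s K Hs). apply filter_imp. intros n Hn. lia.
Qed.

Lemma Cconv_Cexp (a : nat -> R) (l : R) (z : C) :
  is_lim_seq a l -> Cconv (fun n => Cexp (a n * z)) (Cexp (l * z)).
Proof.
  intros H.
  set (x := fun n => (Rabs (a n - l) * Cmod z)%R).
  assert (Hx : is_lim_seq x 0).
  { unfold x. rewrite <- (Rmult_0_l (Cmod z)).
    apply is_lim_seq_mult'; [|apply is_lim_seq_const].
    apply -> is_lim_seq_abs_0. replace 0%R with (l - l)%R by ring.
    apply is_lim_seq_minus'; [easy|apply is_lim_seq_const]. }
  apply Cconv_le with (fun n => Cmod (Cexp (l * z)) * (x n + 10 * (x n * x n)))%R.
  - assert (Hx1 := Hx). apply is_lim_seq_spec in Hx1. generalize (Hx1 (mkposreal 1 Rlt_0_1)).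
    apply filter_imp. intros n Hn. cbn [pos] in Hn. apply Rabs_lt_between in Hn.
    replace (Cexp (a n * z) - Cexp (l * z)) with (Cexp (l * z) * (Cexp (RtoC (a n - l) * z) - 1)).
    2: { replace (a n * z) with (l * z + RtoC (a n - l) * z) by (rewrite RtoC_minus; ring).
         rewrite Cexp_plus. ring. }
    assert (E : Cmod (RtoC (a n - l) * z) = x n) by (rewrite Cmod_mult, Cmod_R; easy).
    rewrite Cmod_mult. apply Rmult_le_compat_l; [apply Cmod_ge_0|].
    set (y := RtoC (a n - l) * z) in *.
    replace (Cexp y - 1) with (y + (Cexp y - 1 - y)) by ring.
    eapply Rle_trans; [apply Cmod_triangle|]. rewrite E.
    assert (Hb := Cexp_bound_quadratic y). rewrite E in Hb. specialize (Hb ltac:(lra)). lra.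
  - replace 0%R with (Cmod (Cexp (l * z)) * (0 + 10 * (0 * 0)))%R by ring.
    apply is_lim_seq_mult'; [apply is_lim_seq_const|].
    apply is_lim_seq_plus'; [easy|].
    apply is_lim_seq_mult'; [apply is_lim_seq_const|now apply is_lim_seq_mult'].
Qed.

(** With [u = PI c / l] the exponent [- m u^2] is exactly [- rho (PI c)^2], and the error bound of
    [Ccos_pow_sub_exp_le] becomes a bounded quantity times [1 / l]. *)
Lemma Ccos_pow_lim (s : R) (c : C) : (0 < s)%R ->
  Cconv (fun n => Ccos (PI * c / INR (lseq n)) ^ (2 * mseq s n)) (Cexp (- (s * (PI * c) ^ 2))).
Proof.
  intros Hs. set (r := Cmod (PI * c)).
  assert (Hz : forall n, RtoC (INR (lseq n)) <> 0)
    by (intros n; apply RtoC_neq_0; generalize (lseq_pos n); lra).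
  apply Cconv_ext with (fun n =>
    (Ccos (PI * c / INR (lseq n)) ^ (2 * mseq s n) - Cexp (rho s n * - (PI * c) ^ 2))
    + Cexp (rho s n * - (PI * c) ^ 2)); [intros n; ring|].
  replace (Cexp (- (s * (PI * c) ^ 2))) with (0 + Cexp (s * - (PI * c) ^ 2))
    by (rewrite Cplus_0_l; f_equal; ring).
  apply Cconv_plus; [|now apply Cconv_Cexp, rho_lim].
  apply Cconv_le with
    (fun n => rho s n * (130 * r ^ 3) * / INR (lseq n) * exp (131 * (rho s n * r ^ 2)))%R.
  - generalize (small_eventually r 1 Rlt_0_1). apply filter_imp. intros n Hn.
    assert (Hl := lseq_pos n). assert (Hm := mseq_rho s n).
    assert (Hu : Cmod (PI * c / INR (lseq n)) = (r / INR (lseq n))%R).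
    { rewrite Cmod_div by easy. rewrite (Cmod_R (INR (lseq n))), Rabs_right by lra. easy. }
    assert (H := Ccos_pow_sub_exp_le (PI * c / INR (lseq n)) (mseq s n)).
    rewrite Hu in H. specialize (H Hn).
    replace (Ccos (PI * c / INR (lseq n)) ^ (2 * mseq s n) - Cexp (rho s n * - (PI * c) ^ 2) - 0)
      with (Ccos (PI * c / INR (lseq n)) ^ (2 * mseq s n) -
        Cexp (INR (mseq s n) * - (PI * c / INR (lseq n)) ^ 2)).
    2: { rewrite Hm, RtoC_mult, RtoC_pow.
         replace (rho s n * INR (lseq n) ^ 2 * - (PI * c / INR (lseq n)) ^ 2)
           with (rho s n * - (PI * c) ^ 2) by (field; easy). ring. }
    eapply Rle_trans; [exact H|]. right. rewrite Hm. f_equal; [|f_equal]; field; lra.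
  - replace 0%R with (s * (130 * r ^ 3) * 0 * exp (131 * (s * r ^ 2)))%R by ring.
    assert (Hr := rho_lim s Hs).
    apply is_lim_seq_mult'; [apply is_lim_seq_mult'; [apply is_lim_seq_mult'|]|].
    + exact Hr.
    + apply is_lim_seq_const.
    + apply lseq_inv_lim.
    + apply is_lim_seq_exp, is_lim_seq_mult'; [apply is_lim_seq_const|].
      apply is_lim_seq_mult'; [exact Hr|apply is_lim_seq_const].
Qed.

Lemma Ccos_side_lim (s : R) (w : C) : (0 < s)%R ->
  exists l : C,
    is_Zseries (fun k => Cexp (- (s * (PI * (w - k)) ^ 2))) l /\
    Cconv (fun n => zsum (fun k => Ccos (PI * (w - k) / INR (lseq n)) ^ (2 * mseq s n)) (S n)) l.
Proof.
  intros Hs. assert (HP := PI_RGT_0).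
  (* In the majorant the growth term uses [rho <= s + 1] and the decay term uses [s <= rho]. *)
  apply zsum_dominated_convergence
    with (M := fun k => exp ((s + 1) * (10 * (PI * Cmod w) ^ 2) + 0 * INR k
                             - s * PI ^ 2 / 18 * INR k ^ 2)).
  - apply ex_series_gaussian. assert (0 < PI ^ 2)%R by (apply pow_lt; easy).
    apply Rdiv_lt_0_compat; [apply Rmult_lt_0_compat|]; lra.
  - generalize (small_eventually (PI * Cmod w) 1 Rlt_0_1). apply filter_imp.
    intros n Hn k Hk.
    assert (Hl := lseq_pos n). assert (Hm := mseq_rho s n).
    assert (Hz : RtoC (INR (lseq n)) <> 0) by (apply RtoC_neq_0; lra).
    (* The real point that carries the dependence on [k]; the argument of the cosine differs from it
       by [PI w / l]. *)
    set (x := (- (PI * IZR k / INR (lseq n)))%R).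
    assert (Hx2 : (x ^ 2 = (PI * INR (Z.abs_nat k)) ^ 2 / INR (lseq n) ^ 2)%R).
    { unfold x. rewrite INR_abs_nat, Rpow_mult_distr, pow2_abs. field. lra. }
    eapply Rle_trans; [apply (Ccos_pow_le _ x (PI * Cmod w / INR (lseq n)))|].
    (* Here the centred range matters: [|k| <= n + 1 = l / 2] gives [|x| <= PI / 2]. *)
    + unfold x. rewrite Rabs_Ropp. unfold Rdiv.
      rewrite !Rabs_mult, (Rabs_right PI), (Rabs_right (/ _)) by
        (lra || (left; now apply Rinv_0_lt_compat)).
      rewrite Rmult_assoc. apply Rmult_le_compat_l; [lra|].
      apply (Rmult_le_reg_r (INR (lseq n))); [easy|].
      rewrite Rmult_assoc, Rinv_l, Rmult_1_r by lra.
      unfold lseq. rewrite mult_INR. change (INR 2) with 2%R.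
      replace (/ 2 * (2 * INR (S n)))%R with (INR (S n)) by field.
      rewrite INR_IZR_INZ. apply Rabs_le. rewrite <- opp_IZR. split; apply IZR_le; lia.
    + right. replace (PI * (w - k) / INR (lseq n) - x) with (PI * w / INR (lseq n)).
      * rewrite Cmod_div, Cmod_mult, Cmod_PI, Cmod_R, Rabs_right by (easy || lra). easy.
      * unfold x, IZC. rewrite RtoC_opp, RtoC_div, RtoC_mult by lra. field. easy.
    + easy.
    + apply exp_le_exp. rewrite Hm, Hx2.
      destruct (rho_bounds s n Hs) as [R1 _]. assert (R2 := rho_le s n Hs).
      set (a := Z.abs_nat k).
      replace (rho s n * INR (lseq n) ^ 2 * (10 * (PI * Cmod w / INR (lseq n)) ^ 2
        - (PI * INR a) ^ 2 / INR (lseq n) ^ 2 / 18))%R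
        with (rho s n * (10 * (PI * Cmod w) ^ 2) - rho s n * ((PI * INR a) ^ 2 / 18))%R
        by (field; lra).
      assert (P1 := pow2_ge_0 (PI * Cmod w)). assert (P2 := pow2_ge_0 (PI * INR a)).
      assert (rho s n * (10 * (PI * Cmod w) ^ 2) <= (s + 1) * (10 * (PI * Cmod w) ^ 2))%R
        by (apply Rmult_le_compat_r; lra).
      assert (s * ((PI * INR a) ^ 2 / 18) <= rho s n * ((PI * INR a) ^ 2 / 18))%R
        by (apply Rmult_le_compat_r; lra).
      replace (s * PI ^ 2 / 18 * INR a ^ 2)%R with (s * ((PI * INR a) ^ 2 / 18))%R by field.
      lra.
  - intros k. now apply Ccos_pow_lim.
  - intros K. exists K. intros n Hn. lia.
Qed.

(** Both sides of [zsum_Ccos_pow] converge, so their limits agree. The prefactor is handled by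
    [m = rho l^2], which gives [l central(m) = sqrt m central(m) / sqrt rho], with limit
    [kappa / sqrt s]. *)
Lemma gaussian_transformation_up_to_constant (kappa s : R) (w : C) :
  is_lim_seq (fun m => sqrt (INR m) * central m)%R kappa -> (0 < s)%R ->
  exists A B : C,
    is_Zseries (fun k => Cexp (- (s * (PI * (w - k)) ^ 2))) A /\
    is_Zseries (fun v => exp (- (IZR v ^ 2 / s)) * Cexp (2 * PI * Ci * v * w)) B /\
    A = RtoC (kappa / sqrt s) * B.
Proof.
  intros Hk Hs.
  destruct (Ccos_side_lim s w Hs) as [A [HA LA]].
  destruct (beta_side_lim s w Hs) as [B [HB LB]].
  exists A, B. split; [easy|split; [easy|]].
  apply (Cconv_unique _ _ _ LA).
  apply Cconv_ext with (fun n => RtoC (INR (lseq n) * central (mseq s n)) *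
    zsum (fun v => beta (mseq s n) (Z.of_nat (lseq n) * v) * Cexp (2 * PI * Ci * v * w))
      (S (mseq s n))).
  { intros n. unfold lseq. rewrite zsum_Ccos_pow by lia. now rewrite RtoC_mult. }
  apply Cconv_mult; [|exact LB]. apply Cconv_RtoC.
  apply is_lim_seq_ext with
    (fun n => sqrt (INR (mseq s n)) * central (mseq s n) / sqrt (rho s n))%R.
  - intros n. assert (Hl := lseq_pos n). destruct (rho_bounds s n Hs) as [R1 _].
    rewrite mseq_rho at 1. rewrite sqrt_mult_alt, sqrt_pow2 by lra.
    field. apply Rgt_not_eq, sqrt_lt_R0. lra.
  - apply is_lim_seq_div'.
    + apply (is_lim_seq_subseq (fun m => sqrt (INR m) * central m)%R _ (mseq s)); [|exact Hk].
      intros P [N HN]. unfold filtermap.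
      generalize (mseq_unbounded s N Hs). apply filter_imp. intros n Hn. now apply HN.
    + apply (is_lim_seq_continuous sqrt); [|now apply rho_lim].
      apply continuity_pt_sqrt. lra.
    + apply Rgt_not_eq, sqrt_lt_R0. lra.
Qed.

(** * Determination of the constant and the theta identity *)

Lemma is_Zseries_ext (a b : Z -> C) (l : C) :
  (forall k, a k = b k) -> is_Zseries a l -> is_Zseries b l.
Proof.
  intros H [lp [ln [Hp [Hn E]]]]. exists lp, ln.
  split; [|split; [|exact E]]; [revert Hp|revert Hn]; apply is_series_ext; intros n; apply H.
Qed.

Lemma Cconv_Re_ge (f : nat -> C) (l : C) (c : R) :
  (forall n, c <= Re (f n))%R -> Cconv f l -> (c <= Re l)%R.
Proof.
  intros H Hf.
  assert (H1 : Rbar_le (c - Re l)%R 0%R).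
  { apply (is_lim_seq_le (fun _ => c - Re l)%R (fun n => Cmod (f n - l))); [|apply is_lim_seq_const|exact Hf].
    intros n. specialize (H n).
    apply Rle_trans with (Re (f n - l)); [unfold Cminus; simpl; destruct (f n), l; simpl in *; lra|].
    eapply Rle_trans; [apply Rle_abs|apply re_le_Cmod]. }
  simpl in H1. lra.
Qed.

Lemma csum_Re_nonneg (f : nat -> C) (n : nat) :
  (forall k, 0 <= Re (f k))%R -> (0 <= Re (csum f n))%R.
Proof.
  intros H. induction n as [|n IH]; simpl; [lra|].
  specialize (H n). unfold Re in *. simpl. lra.
Qed.

(** The term at 0 alone bounds the real part of the sum from below. This shows that the self-dual
    sum is nonzero and may be cancelled. *)
Lemma Zseries_pos (a : Z -> C) (l : C) :
  (forall k, 0 < Re (a k))%R -> is_Zseries a l -> (0 < Re l)%R.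
Proof.
  intros H [lp [ln [Hp [Hn ->]]]]. rewrite is_series_Cconv in Hp, Hn.
  assert (H1 : (Re (a 0%Z) <= Re lp)%R).
  { apply (Cconv_Re_ge _ _ _ ) with (2 := Hp). intros n. rewrite csum_S_l.
    assert (H1 := csum_Re_nonneg (fun k => a (Z.of_nat (S k))) n (fun k => Rlt_le _ _ (H _))).
    change (Re (a 0%Z) <= Re (a 0%Z) + Re (csum (fun k => a (Z.of_nat (S k))) n))%R. lra. }
  assert (H2 : (0 <= Re ln)%R).
  { apply (Cconv_Re_ge _ _ _ ) with (2 := Hn). intros n.
    apply csum_Re_nonneg. intros k. left. apply H. }
  specialize (H 0%Z). unfold Re in *. simpl. lra.
Qed.

(** At [s = 1 / PI] and [w = 0] both series have the terms [exp (- PI k^2)]; cancelling their common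
    positive sum leaves [kappa / sqrt (1 / PI) = 1]. *)
Lemma central_sqrt_lim : is_lim_seq (fun m => sqrt (INR m) * central m)%R (/ sqrt PI)%R.
Proof.
  destruct central_sqrt_cv as [kappa Hk].
  assert (HP := PI_RGT_0).
  assert (HsP : (0 < sqrt PI)%R) by now apply sqrt_lt_R0.
  destruct (gaussian_transformation_up_to_constant kappa (/ PI) 0 Hk) as [A [B [HA [HB E]]]].
  { now apply Rinv_0_lt_compat. }
  assert (HT : forall k : Z, Cexp (- (RtoC (/ PI) * (PI * (0 - k)) ^ 2)) = exp (- (PI * IZR k ^ 2))).
  { intros k. rewrite <- Cexp_RtoC. f_equal. unfold IZC.
    rewrite RtoC_opp, RtoC_mult, RtoC_pow, RtoC_inv by lra. field. apply RtoC_neq_0. lra. }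
  assert (HAB : A = B).
  { apply (is_Zseries_unique _ _ _ HA). revert HB. apply is_Zseries_ext. intros k.
    rewrite HT. replace (2 * PI * Ci * k * 0) with (RtoC 0) by ring.
    rewrite Cexp_0, Cmult_1_r. do 3 f_equal. field. lra. }
  assert (HA0 : (0 < Re A)%R).
  { apply (Zseries_pos _ _) with (2 := HA). intros k. rewrite HT. apply exp_pos. }
  rewrite <- HAB in E. apply (f_equal Re) in E.
  replace (Re (RtoC (kappa / sqrt (/ PI)) * A)) with (kappa / sqrt (/ PI) * Re A)%R in E
    by (destruct A; simpl; ring).
  assert (E1 : (kappa / sqrt (/ PI) = 1)%R) by (apply (Rmult_eq_reg_r (Re A)); lra).
  rewrite sqrt_inv in E1.
  replace (/ sqrt PI)%R with kappa; [exact Hk|].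
  transitivity (kappa / / sqrt PI * / sqrt PI)%R; [field; lra|rewrite E1; ring].
Qed.

(** For [s = 1 / (PI^2 d)] the factor [kappa / sqrt s] is [PI sqrt d / sqrt PI = sqrt (PI d)], and
    [- v^2 / s = - PI^2 d v^2] is the quadratic exponent [PI i v^2 tau] at [tau = i PI d]. *)
Lemma gaussian_transformation (d : R) (w : C) : (0 < d)%R ->
  exists A B : C,
    is_Zseries (fun n : Z => Cexp (- ((w - n) ^ 2 / d))) A /\
    is_Zseries (theta3_term (PI * w) (Ci * PI * d)) B /\
    / sqrt (PI * d) * A = B.
Proof.
  intros Hd. assert (HP := PI_RGT_0).
  assert (HPC : RtoC PI <> 0) by (apply RtoC_neq_0; lra).
  assert (HdC : RtoC d <> 0) by (apply RtoC_neq_0; lra).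
  assert (Hs : (0 < / (PI ^ 2 * d))%R)
    by (apply Rinv_0_lt_compat, Rmult_lt_0_compat; [apply pow_lt|]; easy).
  destruct (gaussian_transformation_up_to_constant _ _ w central_sqrt_lim Hs)
    as [A [B [HA [HB E]]]].
  exists A, B. split; [|split].
  - revert HA. apply is_Zseries_ext. intros n. f_equal.
    rewrite RtoC_inv, RtoC_mult, RtoC_pow by (apply Rgt_not_eq, Rmult_lt_0_compat; [apply pow_lt|]; easy).
    field. easy.
  - revert HB. apply is_Zseries_ext. intros n. unfold theta3_term.
    rewrite <- Cexp_RtoC, <- Cexp_plus. f_equal.
    replace (IZR n ^ 2 / / (PI ^ 2 * d))%R with (IZR n ^ 2 * (PI ^ 2 * d))%R by (field; split; lra).
    assert (HCi : Ci * Ci = - (1)) by (apply C_eq; simpl; ring).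
    replace (2 * Ci * n * (PI * w) + PI * Ci * n ^ 2 * (Ci * PI * d))
      with (2 * Ci * n * (PI * w) + Ci * Ci * (n ^ 2 * (PI ^ 2 * d))) by ring.
    rewrite HCi, RtoC_opp, !RtoC_mult, !RtoC_pow. unfold IZC. ring.
  - rewrite E. rewrite sqrt_inv, !sqrt_mult_alt, sqrt_pow2 by (try apply pow2_ge_0; lra).
    assert (S1 := sqrt_lt_R0 PI HP). assert (S2 := sqrt_lt_R0 d Hd).
    assert (S3 := sqrt_sqrt PI ltac:(lra)).
    rewrite Cmult_assoc, <- RtoC_inv, <- RtoC_mult by (apply Rgt_not_eq, Rmult_lt_0_compat; easy).
    replace (/ (sqrt PI * sqrt d) * (/ sqrt PI / / (PI * sqrt d)))%R with 1%R; [ring|].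
    rewrite <- S3 at 3. field. lra.
Qed.

(** Convergence is asserted next to each identity because [Zseries] has an unspecified value on a
    divergent series. The first form is [gaussian_transformation] at [w = z / PI], the second at
    [w = z]. *)
Theorem theorem2p1 (d : R) (hd : (0 < d)%R) :
  (forall z : C,
     ex_Zseries (fun n : Z => Cexp (- ((z - n * PI) ^ 2 / (d * PI ^ 2)))) /\
     ex_Zseries (theta3_term z (Ci * PI * d)) /\
     / sqrt (PI * d) *
       Zseries (fun n : Z => Cexp (- ((z - n * PI) ^ 2 / (d * PI ^ 2))))
     = theta3 z (Ci * PI * d)) /\
  (forall z : C,
     ex_Zseries (fun n : Z => Cexp (- ((z - n) ^ 2 / d))) /\
     ex_Zseries (theta3_term (PI * z) (Ci * PI * d)) /\
     / sqrt (PI * d) * Zseries (fun n : Z => Cexp (- ((z - n) ^ 2 / d)))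
     = theta3 (PI * z) (Ci * PI * d)).
Proof.
  assert (HPC : RtoC PI <> 0) by (apply RtoC_neq_0, PI_neq0).
  assert (HdC : RtoC d <> 0) by (apply RtoC_neq_0; lra).
  split; intros z.
  - destruct (gaussian_transformation d (z / PI) hd) as [A [B [HA [HB E]]]].
    replace (PI * (z / PI)) with z in HB by (field; easy).
    apply (is_Zseries_ext _ (fun n : Z => Cexp (- ((z - n * PI) ^ 2 / (d * PI ^ 2))))) in HA.
    2: { intros n. f_equal. field. easy. }
    unfold theta3. rewrite (Zseries_unique _ _ HA), (Zseries_unique _ _ HB).
    split; [now exists A|split; [now exists B|exact E]].
  - destruct (gaussian_transformation d z hd) as [A [B [HA [HB E]]]].
    unfold theta3. rewrite (Zseries_unique _ _ HA), (Zseries_unique _ _ HB).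
    split; [now exists A|split; [now exists B|exact E]].
Qed.
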